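(* Let $n\le2$ and let $G\subset\mathbb{R}^n$ be a bounded domain with smooth boundary, and let $p\ge2$. Then there exists $C(p,G)>0$ such that for any $\varphi\in C^1(\overline G)$ and $\psi\in C^1(\overline G)$ fulfilling $\varphi\ge0$ and $\psi>0$ in $\overline G$, $$\int_G\frac{\varphi^p}{\psi}|\nabla\psi|^2\le\eta\int_G\varphi^{p-2}\psi|\nabla\varphi|^2+\eta\int_G\varphi\psi+C(p,G)\cdot\Big(1+\frac1\eta\Big)\cdot\left\{\int_G\varphi^p+\Big\{\int_G\varphi\Big\}^{2p-1}\right\}\cdot\int_G\frac{|\nabla\psi|^4}{\psi^3}\qquad\text{for all }\eta>0.$$ *)

(* Defs.v *)
From HB Require Import structures.
From mathcomp Require Import all_boot all_order all_algebra.
From mathcomp Require Import all_classical all_reals all_analysis.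
Import Order.TTheory GRing.Theory Num.Theory.
Import numFieldNormedType.Exports.

Set Implicit Arguments.
Unset Strict Implicit.
Unset Printing Implicit Defensive.

Local Open Scope classical_set_scope.
Local Open Scope ring_scope.

(* As for [n.-tuple T] in the library, the sigma-algebra on row vectors is the
   one generated by the coordinate functions, i.e. the Borel sigma-algebra. *)
Fact rV_display : measure_display.
Proof. exact: default_measure_display. Qed.

Section measurable_rV.
Context {R : realType} {n : nat}.

Definition rV_coor (i : 'I_n) (v : 'rV[R]_n) : measurableTypeR R := v ord0 i.

Let rV_set0 : g_sigma_preimage rV_coor set0.
Proof. exact: sigma_algebra0. Qed.

Let rV_setC A : g_sigma_preimage rV_coor A -> g_sigma_preimage rV_coor (~` A).
Proof. exact: sigma_algebraC. Qed.

Let rV_bigcup (F : (set 'rV[R]_n)^nat) :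
  (forall i, g_sigma_preimage rV_coor (F i)) ->
  g_sigma_preimage rV_coor (\bigcup_i F i).
Proof. exact: sigma_algebra_bigcup. Qed.

HB.instance Definition _ := @isMeasurable.Build rV_display 'rV[R]_n
  (g_sigma_preimage rV_coor) rV_set0 rV_setC rV_bigcup.

Lemma measurable_rV_coor (i : 'I_n) : measurable_fun [set: 'rV[R]_n] (rV_coor i).
Proof.
move=> _ Y mY; rewrite setTI; apply: sub_sigma_algebra => /=.
rewrite -bigcup_seq/=; exists i => /=; first by rewrite mem_index_enum.
by exists Y => //; rewrite setTI.
Qed.

End measurable_rV.

Section lebesgue_rV.
Context {R : realType}.

Lemma measurable_fun_rV d (T : measurableType d) n (f : T -> 'rV[R]_n) :
  (forall i, measurable_fun [set: T] (rV_coor i \o f)) ->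
  measurable_fun [set: T] f.
Proof.
move=> mf _ A mA; rewrite setTI.
suff: (@g_sigma_preimage _ _ _ _ (@rV_coor R n)) `<=` [set B | measurable (f @^-1` B)].
  exact.
apply: smallest_sub.
  split; rewrite /=.
  - by rewrite preimage_set0.
  - by move=> B mB; rewrite setTD preimage_setC; exact: measurableC.
  - by move=> F mF; rewrite preimage_bigcup; exact: bigcupT_measurable.
rewrite -bigcup_seq/=; apply: bigcup_sub => i _ B [C mC <-] /=.
rewrite setTI -comp_preimage -[X in measurable X]setTI.
exact: mf.
Qed.

Definition rV_cons n (z : 'rV[R]_n * measurableTypeR R) : 'rV[R]_n.+1 :=
  row_mx (z.2%:M : 'rV[R]_1) z.1.

Lemma measurable_rV_cons n : measurable_fun setT (@rV_cons n).
Proof.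
apply: measurable_fun_rV => i.
case: (@split_ordP 1 n i) => j ->.
- rewrite [X in measurable_fun _ X](_ : _ = snd) //.
  apply/funext => z /=; rewrite /rV_coor /rV_cons (@row_mxEl _ _ 1) !ord1.
  by rewrite mxE mulr1n.
- rewrite [X in measurable_fun _ X](_ : _ = rV_coor j \o fst).
    apply: measurableT_comp => //; exact: measurable_rV_coor.
  by apply/funext => z /=; rewrite /rV_coor /rV_cons (@row_mxEr _ _ 1).
Qed.

(* n-dimensional Lebesgue measure, as the image of the product of the
   (n-1)-dimensional and the 1-dimensional ones.  The canonical measure structure
   of [pushforward] is named explicitly because its measurability argument
   cannot be inferred. *)
Fixpoint lebesgue_rV (n : nat) : {measure set 'rV[R]_n -> \bar R} :=
  if n is m.+1 then
    measure_function_pushforward__canonical__measure_function_Measure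
      (lebesgue_rV m \x @lebesgue_measure R)%E (@measurable_rV_cons m)
  else \d_(0 : 'rV[R]_0).

End lebesgue_rV.

Section calculus_rV.
Context {R : realType} {n : nat}.
Implicit Types (G : set 'rV[R]_n) (f : 'rV[R]_n -> R).

Definition evec (i : 'I_n) : 'rV[R]_n := delta_mx ord0 i.

Definition partial (i : 'I_n) f (x : 'rV[R]_n) : R := 'D_(evec i) f x.

(* Euclidean norm of the gradient; the library norm on ['rV_n] is the sup norm *)
Definition grad_norm f (x : 'rV[R]_n) : R :=
  Num.sqrt (\sum_(i < n) partial i f x ^+ 2).

Fixpoint Ck (k : nat) f : Prop :=
  continuous f /\
  if k is l.+1 then
    forall i, (forall x, derivable f x (evec i)) /\ Ck l (partial i f)
  else True.

Definition smooth f : Prop := forall k, Ck k f.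

(* [C^1] on the closure of an open set [G]: [f] is continuous on the closure, and
   its partial derivatives exist in [G] and extend continuously to the closure. *)
Definition C1_closure G f : Prop :=
  {within closure G, continuous f} /\
  forall i, (forall x, G x -> derivable f x (evec i)) /\
    exists2 g : 'rV[R]_n -> R, {within closure G, continuous g} &
      forall x, G x -> g x = partial i f x.

Definition bounded_domain G : Prop :=
  [/\ open G, connected G, G !=set0 & bounded_set G].

End calculus_rV.

(* Near each boundary point, up to the choice of a coordinate axis [i] and of
   its orientation [s], [G] is the set of points above the graph of a smooth
   function of the n-1 other coordinates [col' i x]. *)
Definition smooth_boundary {R : realType} {n : nat} (G : set 'rV[R]_n) : Prop :=
  forall x0, (closure G `&` closure (~` G)) x0 ->
  exists r : R, exists i : 'I_n, exists s : bool,
  exists gamma : 'rV[R]_n.-1 -> R,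
  [/\ 0 < r, smooth gamma &
      forall x, ball x0 r x -> (G x <-> gamma (col' i x) < (-1) ^+ s * x ord0 i)].

(* Main.v *)
Require Import Defs.
From mathcomp Require Import all_boot all_order all_algebra.
From mathcomp Require Import all_classical all_reals all_analysis.
From mathcomp Require Import measurable_realfun.
From mathcomp Require Import ring lra.
Import Order.TTheory GRing.Theory Num.Theory.
Import numFieldNormedType.Exports.

(** Write X for the integral on the left, A, B, P, M, D for the integrals of
[phi^(p-2) psi |grad phi|^2], [phi psi], [phi^p], [phi], [|grad psi|^4 / psi^3],
and put [w = phi^p psi^(1/2)] ([weight]).

The integrand of X is the product of [w] and [|grad psi|^2 psi^(-3/2)], so by
Cauchy-Schwarz X is at most [||w||_2 D^(1/2)] ([lhs_le_weight]). In dimension at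
most two W^{1,1}(G) embeds into L^2(G) ([sobolev_W11_L2]), so [||w||_2] is bounded
by the L^1 norms of [w] and of its gradient. The gradient consists of
[phi^(p-1) psi^(1/2) grad phi] and [phi^p psi^(-1/2) grad psi] up to constants,
whose L^1 norms are at most [(A P)^(1/2)] and [(X P)^(1/2)] by Cauchy-Schwarz
([gradient_weight_integral]). The L^1 norm of [w] is interpolated between
[||w||_2], which is absorbed, and the quasi-norm of exponent [1/p]
([absorb_lower_order]); since [w^(1/p) = phi psi^(1/(2p))], Hoelder's inequality
bounds the latter by [B^(1/2) (M^(2p-1))^(1/2)] ([weight_small_power]). Hence X is
at most a constant times
[((A P)^(1/2) + (X P)^(1/2) + (B M^(2p-1))^(1/2)) D^(1/2)], and Young's inequality
gives the claim ([young_absorption]).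

For the embedding, the closure of G is covered by finitely many charts
[Phi(t, v)] whose image is the part of G at height less than a constant above a
graph, [v] being the height above the graph ([graph_chart]). Such a shear
preserves volumes, and both families of its coordinate curves stay inside G, so
that along them the oscillation of a function is controlled by the integral of
its gradient. Averaging over either variable bounds [w] by a function of [t]
alone and by a function of [v] alone; integrating the product of these bounds
estimates the integral of [w^2] over the chart by the square of an integral over
G ([ge0_integral_sqr_le_prod], [local_sobolev]), and the local estimates are
simply added ([sobolev_by_charts]). *)

Set Implicit Arguments.
Unset Strict Implicit.
Unset Printing Implicit Defensive.

Local Open Scope classical_set_scope.
Local Open Scope ring_scope.

(** * Lebesgue measure on row vectors *)

Section measurability.
Context {R : realType}.

Lemma measurable_ball_rV n (x : 'rV[R]_n) r : measurable (ball x r).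
Proof.
have [r0|r0] := ltP 0 r; last first.
  rewrite (_ : ball x r = set0) ?measurable0//.
  by apply/seteqP; split => // y [+ _]; rewrite ltNge r0.
rewrite (_ : ball x r = \bigcap_(k in [set: 'I_n])
    (@rV_coor R n k @^-1` ball (x ord0 k) r)); last first.
  apply/seteqP; split => [y [_ xy] k _|y xy]; first exact: xy.
  by split => // i k; rewrite ord1; exact: xy.
apply: fin_bigcap_measurable => // k _; rewrite -[X in measurable X]setTI.
apply: measurable_rV_coor => //; exact: measurable_ball.
Qed.

(** Balls of the sup norm are boxes, so they belong to the sigma-algebra
generated by the coordinates, and an open set is the union of the countably
many balls with rational centre and radius [1 / (k + 1)] that it contains. *)
Lemma open_measurable_rV n (A : set 'rV[R]_n) : open A -> measurable A.
Proof.
move=> oA.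
pose c (qk : 'rV[rat]_n * nat) : 'rV[R]_n := map_mx ratr qk.1.
pose F qk : set 'rV[R]_n :=
  if `[< ball (c qk) (qk.2.+1%:R^-1) `<=` A >] then ball (c qk) (qk.2.+1%:R^-1)
  else set0.
have -> : A = \bigcup_qk F qk.
  apply/seteqP; split => [x Ax|x [qk _]]; last first.
    by rewrite /F; case: asboolP => // + xq; exact.
  have /nbhs_ballP[e /= e0 xeA] : nbhs x A by exact: open_nbhs_nbhs.
  have e20 : 0 < e / 2 by rewrite divr_gt0.
  have [k ke] : exists k, k.+1%:R^-1 < e / 2 :> R.
    have [k] := ltr_add_invr e20; rewrite add0r => ke; by exists k.
  have k0 : 0 < k.+1%:R^-1 :> R by rewrite invr_gt0.
  have q_ i : {q : rat | x ord0 i - k.+1%:R^-1 < ratr q < x ord0 i + k.+1%:R^-1}.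
    apply: cid; have [|q] := @rat_in_itvoo R (x ord0 i - k.+1%:R^-1) (x ord0 i + k.+1%:R^-1).
      by rewrite ltrD2l gtrN.
    by rewrite in_itv/=; exists q.
  have qx : ball (c (\row_i sval (q_ i), k)) k.+1%:R^-1 x.
    split => // j i; have -> : x j i = x ord0 i by rewrite ord1.
    rewrite /c !mxE /=; have := svalP (q_ i).
    by rewrite /ball/= ltr_distl.
  exists (\row_i sval (q_ i), k) => //; rewrite /F asboolT//=.
  move=> y qy; apply: xeA; apply: (@le_ball _ _ x (k.+1%:R^-1 + k.+1%:R^-1)).
    by rewrite [leRHS]splitr lerD ?ltW.
  by apply: ball_triangle qy; exact: ball_sym.
apply: countable_bigcupT_measurable => [|qk]; first exact: countableP.
by rewrite /F; case: ifP => _; [exact: measurable_ball_rV|exact: measurable0].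
Qed.

Lemma continuous_in_measurable_rV n (A : set 'rV[R]_n) (f : 'rV[R]_n -> R) :
  open A -> (forall x, A x -> {for x, continuous f}) -> measurable_fun A f.
Proof.
move=> oA cf; apply: (measurability _ (RGenOInfty.measurableE R)) => //.
move=> _ [_ [a ->] <-].
apply: open_measurable_rV; rewrite openE => x [Ax fx].
apply: filterI; first exact: open_nbhs_nbhs.
by apply: (cf x Ax); apply: open_nbhs_nbhs; split => //; exact: interval_open.
Qed.

End measurability.

Section lebesgue_measure_invariance.
Context {R : realType}.
Local Notation mu := (@lebesgue_measure R).

Let refl_shift (s : bool) (c u : R) : measurableTypeR R := (-1) ^+ s * (c + u).

Let measurable_refl_shift s c : measurable_fun setT (refl_shift s c).
Proof. by apply: measurable_funM => //; apply: measurable_funD. Qed.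

(** Translations and reflections of a coordinate are what separates a graph
chart from the standard coordinates; their invariance makes these charts
volume preserving. *)
Lemma lebesgue_measure_refl_shift s (c : R) (A : set R) : measurable A ->
  pushforward mu (refl_shift s c) A = mu A.
Proof.
move=> mA.
pose nu := measure_function_pushforward__canonical__measure_function_Measure
  mu (measurable_refl_shift s c).
apply/esym; apply: (@lebesgue_measure_unique _ nu) => //= _ [[a b]] _ <-.
rewrite /nu /pushforward/=; case: s {nu}.
- rewrite (_ : _ @^-1` _ = `[- b - c, - a - c[%classic); last first.
    apply/seteqP; split => u; rewrite /refl_shift /= !in_itv/= expr1 mulN1r => /andP[? ?];
      apply/andP; split; lra.
  rewrite !lebesgue_measure_itv/= !lte_fin ltrD2r ltrN2.
  by case: ifPn => // _; congr (_%:E); ring.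
- rewrite (_ : _ @^-1` _ = `]a - c, b - c]%classic); last first.
    apply/seteqP; split => u; rewrite /refl_shift /= !in_itv/= expr0 mul1r => /andP[? ?];
      apply/andP; split; lra.
  rewrite !lebesgue_measure_itv/= !lte_fin ltrD2r.
  by case: ifPn => // _; congr (_%:E); ring.
Qed.

Lemma ge0_integral_refl_shift (s : bool) (c : R) (f : R -> \bar R) :
  measurable_fun [set: R] f -> (forall u, 0 <= f u)%E ->
  (\int[mu]_u f u = \int[mu]_u f ((-1) ^+ s * (c + u))%R)%E.
Proof.
move=> mf f0.
pose nu := measure_function_pushforward__canonical__measure_function_Measure
  mu (measurable_refl_shift s c).
transitivity (\int[nu]_u f u)%E.
  apply: eq_measure_integral => A mA _; apply/esym.
  exact: lebesgue_measure_refl_shift.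
have := @ge0_integral_pushforward _ _ (measurableTypeR R) (measurableTypeR R)
  R _ (measurable_refl_shift s c) mu setT f measurableT mf (fun y _ => f0 y).
by rewrite preimage_setT.
Qed.

End lebesgue_measure_invariance.

Section iterated_integrals.
Context {R : realType}.
Local Notation mu := (@lebesgue_measure R).
Local Open Scope ereal_scope.

Lemma ge0_integral_rV1 (f : 'rV[R]_1 -> \bar R) :
  measurable_fun setT f -> (forall x, 0 <= f x) ->
  \int[lebesgue_rV 1]_x f x = \int[mu]_u f (const_mx u).
Proof.
move=> mf f0.
have := @ge0_integral_pushforward _ _ _ _ R _ (@measurable_rV_cons R 0)
  (lebesgue_rV 0 \x mu)%E setT f measurableT mf (fun y _ => f0 y).
rewrite preimage_setT => ->.
have mF : measurable_fun setT (f \o @rV_cons R 0).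
  by apply: measurableT_comp => //; exact: measurable_rV_cons.
rewrite (@fubini_tonelli1 _ _ _ _ R (dirac (0 : 'rV[R]_0)%R) mu _ mF (fun z => f0 _)).
rewrite integral_dirac//=; last first.
  exact: (@measurable_fun_fubini_tonelli_F _ _ _ _ R mu _ mF (fun z => f0 _)).
rewrite diracT mul1e. apply: eq_integral => u _ /=. congr f.
apply/matrixP => i k; rewrite !mxE; case: splitP => j /=; rewrite !mxE ?ord1 ?mulr1n//.

Qed.

Let plane (z : measurableTypeR R * measurableTypeR R) : 'rV[R]_2 :=
  rV_cons (const_mx z.1, z.2).

Let measurable_plane : measurable_fun setT plane.
Proof.
apply: measurableT_comp; first exact: measurable_rV_cons.
apply: measurable_fun_pair => //; apply: measurable_fun_rV => i.
rewrite (_ : _ \o _ = fst); first exact: measurable_fst.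
by apply/funext => z; rewrite /rV_coor /= mxE.
Qed.

Let planeE t u : plane (t, u) = \row_k (if k == ord0 then u else t)%R.
Proof.
apply/rowP => k; rewrite !mxE; case: splitP => j kj; rewrite !mxE.
  have -> : k = ord0 by apply: val_inj; rewrite /= kj ord1.
  by rewrite eqxx !ord1 mulr1n.
by have -> : (k == ord0) = false by apply/negbTE/eqP => k0; move: kj; rewrite k0.
Qed.

Lemma ge0_integral_rV2 (f : 'rV[R]_2 -> \bar R) :
  measurable_fun setT f -> (forall x, 0 <= f x) ->
  \int[lebesgue_rV 2]_x f x =
  \int[mu]_t \int[mu]_u f (\row_k (if k == ord0 then u else t)%R).
Proof.
move=> mf f0.
pose nu := measure_function_pushforward__canonical__measure_function_Measure
  (mu \x mu) measurable_plane.
transitivity (\int[nu]_x f x).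
  apply: eq_measure_integral => A mA _.
  rewrite /nu /= /pushforward /product_measure1.
  have mB : measurable (@rV_cons R 1 @^-1` A).
    by rewrite -[X in measurable X]setTI; exact: measurable_rV_cons.
  rewrite [LHS]ge0_integral_rV1//; last first.
    exact: measurable_fun_xsection.
have := @ge0_integral_pushforward _ _ _ _ R _ measurable_plane (mu \x mu) setT
  f measurableT mf (fun y _ => f0 y).
rewrite preimage_setT => ->.
have mF : measurable_fun setT (f \o plane) by exact: measurableT_comp.
rewrite (@fubini_tonelli1 _ _ _ _ R mu mu _ mF (fun z => f0 _)).
apply: eq_integral => t _; apply: eq_integral => u _ /=.
by rewrite planeE.
Qed.

End iterated_integrals.

Section graph_charts.
Context {R : realType}.
Local Notation mu := (@lebesgue_measure R).

(** The point at height [v] above the graph of [c], for the axis [i] with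
orientation [s]. All coordinates other than [i] are equal to [t]: in dimension
two this is the remaining coordinate, in dimension one [t] is a dummy
parameter, so that the same two-parameter formalism covers both cases. *)
Definition graph_chart n (i : 'I_n) (s : bool) (c : R -> R) (z : R * R) : 'rV[R]_n :=
  \row_k (if k == i then (-1) ^+ s * (c z.1 + z.2) else z.1).

Lemma measurable_graph_chart n (i : 'I_n) s c : measurable_fun setT c ->
  measurable_fun setT (graph_chart i s c : measurableTypeR R * measurableTypeR R -> _).
Proof.
move=> mc; apply: measurable_fun_rV => k.
rewrite /comp /rV_coor; under eq_fun do rewrite mxE.
case: (k == i); last exact: measurable_fst.
apply: measurable_funM => //; apply: measurable_funD => //.
by apply: measurableT_comp => //.
Qed.

Lemma ge0_integral_graph_chart1 (i : 'I_1) s c (t : R) (f : 'rV[R]_1 -> \bar R) :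
  measurable_fun setT f -> (forall x, 0 <= f x)%E ->
  (\int[lebesgue_rV 1]_x f x = \int[mu]_v f (graph_chart i s c (t, v)))%E.
Proof.
move=> mf f0; rewrite ge0_integral_rV1// (@ge0_integral_refl_shift _ s (c t))//.
  apply: eq_integral => v _; congr f; apply/matrixP => j k.
  by rewrite !mxE !ord1 eqxx.
have mcst : measurable_fun setT (fun u : measurableTypeR R => const_mx u : 'rV[R]_1).
  apply: measurable_fun_rV => k; rewrite (_ : _ \o _ = id) ?measurable_id//.
  by apply/funext => u; rewrite /rV_coor /= mxE.
exact: (measurableT_comp mf mcst).
Qed.

Lemma ge0_integral_graph_chart2 (i : 'I_2) s c (f : 'rV[R]_2 -> \bar R) :
  measurable_fun setT c -> measurable_fun setT f -> (forall x, 0 <= f x)%E ->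
  (\int[lebesgue_rV 2]_x f x =
   \int[mu]_t \int[mu]_v f (graph_chart i s c (t, v)))%E.
Proof.
move=> mc mf f0; rewrite (ge0_integral_rV2 mf f0).
have mrow (j : 'I_2) (g h : R * R -> R) : measurable_fun setT g -> measurable_fun setT h ->
   measurable_fun setT (fun z : R * R => f (\row_k if k == j then g z else h z)).
  move=> mg mh; apply: measurableT_comp => //; apply: measurable_fun_rV => k.
  rewrite (_ : _ \o _ = if k == j then g else h); first by case: (k == j).
  by apply/funext => z; rewrite /rV_coor /= mxE; case: (k == j).
transitivity (\int[mu]_t \int[mu]_u f (\row_k if k == i then u else t))%E.
  have [->//|i1] := eqVneq i ord0.
  have m0 := mrow ord0 snd fst measurable_snd measurable_fst.
  rewrite [LHS](@fubini_tonelli _ _ _ _ R mu mu _ m0 (fun z => f0 _)).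
  apply: eq_integral => t _; apply: eq_integral => u _; congr f.
  apply/rowP => k; rewrite !mxE.
  by case: k i1 => -[|[|//]]; case: i => -[|[|//]].
apply: eq_integral => t _.
have mt : measurable_fun setT (fun u : R => f (\row_k if k == i then u else t)).
  have m := mrow i snd fst measurable_snd measurable_fst.
  exact: (measurableT_comp m (measurable_pair1 _)).
rewrite [LHS](@ge0_integral_refl_shift _ s (c t) _ mt (fun u => f0 _)).
by apply: eq_integral => v _; congr f.
Qed.

End graph_charts.

(** * One-variable calculus along curves *)

Section one_variable_calculus.
Context {R : realType}.
Local Notation mu := (@lebesgue_measure R).

Lemma is_derive_cvg (V : normedModType R) (f : V -> R) x v l :
  is_derive x v f l <-> h^-1 * (f (h *: v + x) - f x) @[h --> 0^'] --> l.
Proof.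
split => [[df <-]|fl]; first exact: df.
have fl' : h^-1 *: ((f \o shift x) (h *: v) - f x) @[h --> 0^'] --> l by [].
by split; [apply/cvg_ex; exists l|exact: cvg_lim].
Qed.

Lemma is_derive_line (V : normedModType R) (w : V -> R) (L : R -> V) v s d :
  (forall h, L (h + s) = h *: v + L s) ->
  is_derive (L s) v w d -> is_derive s 1 (fun t => w (L t)) d.
Proof.
move=> Ls /is_derive_cvg wd; apply/is_derive_cvg.
by under eq_fun do rewrite [_ *: 1]mulr1 Ls.
Qed.

Lemma is_derive_line_inv (V : normedModType R) (w : V -> R) (x v : V) (d : R) :
  is_derive (0 : R) 1 (fun t : R => w (t *: v + x)) d -> is_derive x v w d.
Proof.
move=> /is_derive_cvg wd; apply/is_derive_cvg.
by move: wd; under eq_fun do rewrite [_ *: 1]mulr1 addr0 scale0r add0r.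
Qed.

(** The fundamental theorem of calculus on the segment between the two points,
which stays inside the open interval, so that no boundary value of [f] enters. *)
Lemma oscillation_le_integral (a b : R) (f f' g : R -> R) :
  (forall t, t \in `]a, b[ -> is_derive t 1 f (f' t)) ->
  (forall t, t \in `]a, b[ -> {for t, continuous f'}) ->
  (forall t, t \in `]a, b[ -> `|f' t| <= g t) ->
  measurable_fun `]a, b[ g ->
  forall x y, x \in `]a, b[ -> y \in `]a, b[ ->
  (`|f y - f x|%:E <= \int[mu]_(t in `]a, b[) (g t)%:E)%E.
Proof.
move=> df cf' f'g mg.
have main x y : x \in `]a, b[ -> y \in `]a, b[ -> x < y ->
    (`|f y - f x|%:E <= \int[mu]_(t in `]a, b[) (g t)%:E)%E.
  move=> xab yab xy.
  have sub : `[x, y] `<=` `]a, b[%classic.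
    move=> t; rewrite /= !in_itv/= => /andP[xt ty].
    move: xab yab; rewrite !in_itv/= => /andP[ax _] /andP[_ yb].
    by rewrite (lt_le_trans ax)// (le_lt_trans ty).
  have c t : t \in `]a, b[ -> f z @[z --> t] --> f t.
    by move=> /df h; apply: differentiable_continuous; apply/derivable1_diffP; case: h.
  have cf'xy : {within `[x, y], continuous f'}.
    by apply: continuous_in_subspaceT => t /set_mem /sub; exact: cf'.
  have fI : (\int[mu]_(t in `[x, y]) (f' t)%:E)%E = (f y - f x)%:E.
    rewrite (@continuous_FTC2 _ f' f) ?EFinB//.
      split.
      - by move=> t /subset_itv_oo_cc /sub /df [].
      - by apply: cvg_at_right_filter; apply: c; apply: sub; rewrite /= in_itv/= lexx ltW.
      - by apply: cvg_at_left_filter; apply: c; apply: sub; rewrite /= in_itv/= lexx ltW.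
    move=> t /subset_itv_oo_cc /sub /df [_ <-]; exact: derive1E.
  have mf' : measurable_fun `[x, y] f'.
    by apply: subspace_continuous_measurable_fun.
  apply: (@le_trans _ _ (\int[mu]_(t in `[x, y]) (`|f' t|)%:E)%E).
    rewrite -[leLHS]/(`|(f y - f x)%:E|)%E -fI.
    by apply: (le_abse_integral mu) => //; exact/measurable_EFinP.
  apply: (@le_trans _ _ (\int[mu]_(t in `[x, y]) (g t)%:E)%E).
    apply: ge0_le_integral => //.
    - exact/measurable_EFinP/measurableT_comp.
    - by apply/measurable_EFinP; exact: measurable_funS mg.
    - by move=> t /sub; rewrite lee_fin; exact: f'g.
  apply: ge0_subset_integral => //; first exact/measurable_EFinP.
  by move=> t /f'g; rewrite lee_fin; exact: le_trans.
move=> x y xab yab; have [xy|yx|->] := ltgtP x y; first exact: main.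
- by rewrite distrC; exact: main.
- rewrite subrr normr0; apply: integral_ge0 => t /f'g.
  by rewrite lee_fin; exact: le_trans.
Qed.

(** A chain rule that starts from partial derivatives only. The increment of
[F] along the graph is split at the point [(t, c t0)]: the horizontal part is
the partial derivative in [t], and the vertical part is [D] at an intermediate
point, given by the mean value theorem, times the increment of [c]; the
continuity of [D] at the base point then gives the limit. *)
Lemma is_derive_along_graph (F D : R -> R -> R) (c : R -> R) (t0 d c' r : R) :
  0 < r ->
  (forall t u, `|t - t0| < r -> `|u - c t0| < r -> is_derive u 1 (F t) (D t u)) ->
  {for (t0, c t0), continuous (fun z => D z.1 z.2)} ->
  is_derive t0 1 (F ^~ (c t0)) d ->
  is_derive t0 1 c c' ->
  is_derive t0 1 (fun t => F t (c t)) (d + D t0 (c t0) * c').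
Proof.
move=> r0 dF cD dF0 dc.
have cc : c z @[z --> t0] --> c t0.
  by apply: differentiable_continuous; apply/derivable1_diffP; case: dc.
pose E t := F t (c t) - F t (c t0).
rewrite (_ : (fun t => F t (c t)) = F ^~ (c t0) + E); last first.
  by apply/funext => t; rewrite /E /= [RHS]/GRing.add/= addrC subrK.
apply: is_deriveD; apply/is_derive_cvg.
have mvt t : `|t - t0| < r -> `|c t - c t0| < r ->
    exists xi, `|xi - c t0| <= `|c t - c t0| /\ E t = D t xi * (c t - c t0).
  move=> tr ctr.
  have dFt u : `|u - c t0| <= `|c t - c t0| -> is_derive u 1 (F t) (D t u).
    by move=> ur; apply: dF => //; exact: le_lt_trans ctr.
  have cFt u : `|u - c t0| <= `|c t - c t0| -> {for u, continuous (F t)}.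
    by move=> /dFt [h _]; apply: differentiable_continuous; exact/derivable1_diffP.
  have seg u a b : a <= u <= b -> a \in [:: c t; c t0] -> b \in [:: c t; c t0] ->
     `|u - c t0| <= `|c t - c t0|.
    move=> /andP[au ub]; rewrite !inE => /orP[]/eqP ? /orP[]/eqP ?; subst a b.
    - by rewrite (@le_anti _ _ u (c t)) ?au ?ub.
    - by rewrite !ler0_norm ?subr_le0 ?(le_trans au)// lerN2 lerD2r.
    - by rewrite !ger0_norm ?subr_ge0 ?(le_trans au)// lerD2r.
    - by rewrite (@le_anti _ _ u (c t0)) ?au ?ub// subrr normr0.
  have [le|/ltW le] := leP (c t0) (c t).
    have [||xi + eq] := @MVT_segment R (F t) (D t) _ _ le.
    - move=> u; rewrite in_itv/= => /andP[? ?]; apply: dFt.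
      by apply: (seg _ (c t0) (c t)); rewrite ?inE ?eqxx ?orbT// !ltW.
    - apply: continuous_in_subspaceT => u /set_mem; rewrite /= in_itv/= => ?; apply: cFt.
      by apply: (seg _ (c t0) (c t)); rewrite ?inE ?eqxx ?orbT.
    - rewrite in_itv/= => ?; exists xi; split => //.
      by apply: (seg _ (c t0) (c t)); rewrite ?inE ?eqxx ?orbT.
  have [||xi + eq] := @MVT_segment R (F t) (D t) _ _ le.
  - move=> u; rewrite in_itv/= => /andP[? ?]; apply: dFt.
    by apply: (seg _ (c t) (c t0)); rewrite ?inE ?eqxx ?orbT// !ltW.
  - apply: continuous_in_subspaceT => u /set_mem; rewrite /= in_itv/= => ?; apply: cFt.
    by apply: (seg _ (c t) (c t0)); rewrite ?inE ?eqxx ?orbT.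
  - rewrite in_itv/= => ?; exists xi; split.
      by apply: (seg _ (c t) (c t0)); rewrite ?inE ?eqxx ?orbT.
    by rewrite /E -opprB eq; ring.
have [xi xiP] : exists xi : R -> R, forall t, `|t - t0| < r -> `|c t - c t0| < r ->
    `|xi t - c t0| <= `|c t - c t0| /\ E t = D t (xi t) * (c t - c t0).
  suff [xi h] : {xi : R -> R & forall t, `|t - t0| < r -> `|c t - c t0| < r ->
    `|xi t - c t0| <= `|c t - c t0| /\ E t = D t (xi t) * (c t - c t0)} by exists xi.
  apply: (@choice _ _ (fun t x => `|t - t0| < r -> `|c t - c t0| < r ->
    `|x - c t0| <= `|c t - c t0| /\ E t = D t x * (c t - c t0))) => t.
  have [tr|] := ltP `|t - t0| r; last by exists 0.
  have [ctr|] := ltP `|c t - c t0| r; last by exists 0.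
  by have [x xP] := mvt t tr ctr; exists x.
have cvt : h + t0 @[h --> 0^'] --> t0.
  rewrite -[X in _ --> X]add0r; apply: cvgD; last exact: cvg_cst.
  exact: nbhs_dnbhs.
have nearr : \forall h \near 0^', `|h + t0 - t0| < r.
  near=> h; rewrite distrC; near: h; move/cvgrPdist_lt : cvt => /(_ r r0); exact.
have cct : c (h + t0) @[h --> 0^'] --> c t0 by apply: cvg_comp cvt cc.
have nearc : \forall h \near 0^', `|c (h + t0) - c t0| < r.
  near=> h; rewrite distrC; near: h; move/cvgrPdist_lt : cct => /(_ r r0); exact.
have xic : xi (h + t0) @[h --> 0^'] --> c t0.
  apply/cvgrPdist_lt => e e0; near=> h; rewrite distrC.
  have [||le _] := xiP (h + t0); [by near: h|by near: h|].
  apply: (le_lt_trans le); rewrite distrC; near: h.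
  by move/cvgrPdist_lt : cct => /(_ e e0).
have E0 : E t0 = 0 by rewrite /E subrr.
apply: (@cvg_trans _ ((D (h + t0) (xi (h + t0)) *
    (h^-1 * (c (h *: 1 + t0) - c t0))) @[h --> 0^'])).
  apply: near_eq_cvg; near=> h; rewrite E0 subr0 [_ *: 1]mulr1.
  have [||_ ->] := xiP (h + t0); [by near: h|by near: h|].
  by rewrite mulrCA.
apply: cvgM; last exact: (iffLR (is_derive_cvg _ _ _ _) dc).
exact: (cvg_comp2 cvt xic cD).
Unshelve. all: by end_near. Qed.

End one_variable_calculus.

Section functions_in_charts.
Context {R : realType}.
Local Notation mu := (@lebesgue_measure R).

Definition C1_on n (G : set 'rV[R]_n) (w : 'rV[R]_n -> R) :=
  forall i x, G x -> derivable w x (evec i) /\ {for x, continuous (partial i w)}.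

Lemma within_closure_continuous n (G : set 'rV[R]_n) (f : 'rV[R]_n -> R) x :
  open G -> {within closure G, continuous f} -> G x -> {for x, continuous f}.
Proof.
move=> oG cf Gx; have := continuous_subspaceW (@subset_closure _ G) cf.
by rewrite continuous_open_subspace// => /(_ x (mem_set Gx)).
Qed.

Lemma C1_closure_on n (G : set 'rV[R]_n) (w : 'rV[R]_n -> R) :
  open G -> C1_closure G w -> C1_on G w.
Proof.
move=> oG [_ dw] i x Gx; have [df [g cg gE]] := dw i; split; first exact: df.
have cgx := within_closure_continuous oG cg Gx.
have e : \forall y \near x, g y = partial i w y.
  by apply: filterS gE _; exact: open_nbhs_nbhs.
rewrite /prop_for /continuous_at -gE//.
by apply: cvg_trans cgx; exact: near_eq_cvg e.
Qed.

Lemma cvg_rV n (T : Type) (F : set_system T) (f : T -> 'rV[R]_n) (l : 'rV[R]_n) :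
  Filter F -> (forall k, f x ord0 k @[x --> F] --> l ord0 k) -> f x @[x --> F] --> l.
Proof.
move=> FF fl; apply/cvg_ballP => e e0.
have : F [set x | forall k, ball (l ord0 k) e (f x ord0 k)].
  by apply: filter_forall => k; move/cvg_ballP: (fl k) => /(_ e e0).
by apply: filterS => x xP; split => // j k; rewrite (ord1 j); exact: xP.
Qed.

Lemma cvg_sumr (I : finType) (P : pred I) (T : Type) (F : set_system T)
    {FF : Filter F} (f : I -> T -> R) (l : I -> R) :
  (forall k, P k -> f k z @[z --> F] --> l k) ->
  \sum_(k | P k) f k z @[z --> F] --> \sum_(k | P k) l k.
Proof. by move=> fl; apply: cvg_big => //; exact: add_continuous. Qed.

Lemma cvg_graph_chart n (i : 'I_n) s (c : R -> R) (T : Type) (F : set_system T)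
    (x y : T -> R) t v :
  Filter F -> x z @[z --> F] --> t -> y z @[z --> F] --> v ->
  c (x z) @[z --> F] --> c t ->
  graph_chart i s c (x z, y z) @[z --> F] --> graph_chart i s c (t, v).
Proof.
move=> FF xt yv ct; apply: cvg_rV => k; under eq_fun do rewrite mxE /=.
rewrite mxE /=; case: (k == i) => //.
by apply: cvgM; [exact: cvg_cst|exact: cvgD].
Qed.

Definition gradient_l1 n (w : 'rV[R]_n -> R) x := \sum_k `|partial k w x|.

Lemma partial_le_gradient_l1 n (w : 'rV[R]_n -> R) x k :
  `|partial k w x| <= gradient_l1 w x.
Proof. by rewrite /gradient_l1 (bigD1 k)//= lerDl sumr_ge0. Qed.

Lemma graph_chartE n (i : 'I_n) s (c : R -> R) t v :
  graph_chart i s c (t, v) = graph_chart i s (cst 0) (t, c t + v).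
Proof. by apply/rowP => k; rewrite !mxE /= add0r. Qed.

Lemma is_derive_chart_v n (i : 'I_n) s (c : R -> R) (w : 'rV[R]_n -> R) t v :
  derivable w (graph_chart i s c (t, v)) (evec i) ->
  is_derive v 1 (fun v => w (graph_chart i s c (t, v)))
    ((-1) ^+ s * partial i w (graph_chart i s c (t, v))).
Proof.
move=> dw.
pose P (r : R) : 'rV[R]_n := \row_k if k == i then r else t.
pose h (v : R) : R := (-1) ^+ s * (c t + v).
have dh : is_derive v 1 h ((-1) ^+ s).
  have dh : is_derive v 1 ((-1) ^+ s \*: (cst (c t) + id)) ((-1) ^+ s *: (0 + 1)).
    exact: is_deriveZ.
  by apply: (is_derive_eq dh); rewrite add0r [LHS]mulr1.
have dwP : is_derive (h v) 1 (w \o P) (partial i w (graph_chart i s c (t, v))).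
  apply: (@is_derive_line _ _ _ P (evec i)); last exact: derivableP.
  move=> r; apply/rowP => k; rewrite !mxE eqxx /=; case: (k == i) => /=.
    by rewrite mulr1.
  by rewrite mulr0 add0r.
rewrite mulrC; exact: (is_derive1_comp dwP dh).
Qed.

(** At most one coordinate differs from [i] in dimension at most two, so at
fixed height the derivative in [t] is a single partial derivative, or zero; the
slope [c'] adds the contribution of the coordinate [i]. *)
Lemma is_derive_chart_t n (i : 'I_n) s (c : R -> R) (G : set 'rV[R]_n)
    (w : 'rV[R]_n -> R) t v c' :
  (n <= 2)%N -> open G -> C1_on G w -> G (graph_chart i s c (t, v)) ->
  is_derive t 1 c c' ->
  is_derive t 1 (fun t => w (graph_chart i s c (t, v)))
    (\sum_(k | k != i) partial k w (graph_chart i s c (t, v)) +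
     (-1) ^+ s * partial i w (graph_chart i s c (t, v)) * c').
Proof.
move=> n2 oG dw Gtv dc.
pose P t u : 'rV[R]_n := graph_chart i s (cst 0) (t, u).
have cP z : (P x.1 x.2) @[x --> z] --> P z.1 z.2.
  by apply: cvg_graph_chart; [exact: cvg_fst|exact: cvg_snd|exact: cvg_cst].
have PE t' : graph_chart i s c (t', v) = P t' (c t' + v) by exact: graph_chartE.
have [r r0 Pr] : exists2 r, 0 < r & forall t' u, `|t' - t| < r ->
    `|u - (c t + v)| < r -> G (P t' u).
  have : \forall z \near (t, c t + v), G (P z.1 z.2).
    by apply: (cP (t, c t + v)); apply: open_nbhs_nbhs; split => //=; rewrite -PE.
  move=> /nbhs_ballP[r /= r0 zr]; exists r => // t' u t'r ur.
  by apply: (zr (t', u)); split; rewrite /ball/= distrC.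
have dc' : is_derive t 1 (fun t => c t + v) c'.
  have dcv : is_derive t 1 (c + cst v) (c' + 0).
    exact: (is_deriveD dc (is_derive_cst v t 1)).
  by apply: (is_derive_eq dcv); rewrite addr0.
rewrite (_ : (fun _ => _) = fun t => w (P t (c t + v))); last first.
  by apply/funext => t'; rewrite PE.
rewrite !PE.
apply: (@is_derive_along_graph _ (fun t u => w (P t u))
  (fun t u => (-1) ^+ s * partial i w (P t u)) (fun t => c t + v) t _ c' r r0) => //.
- move=> t' u t'r ur; apply: is_derive_chart_v; have [] := dw i _ (Pr t' u t'r ur); done.
- apply: cvgM; first exact: cvg_cst.
  apply: cvg_comp (cP (t, c t + v)) _ => /=.
  by rewrite -PE; have [] := dw i _ Gtv.
- rewrite -PE {cP PE Pr dc dc'}/P.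
  case: n n2 i G w oG dw Gtv => [|[|[|//]]] n2 i G w oG dw Gtv.
  + by case: i Gtv.
  + rewrite big1 => [|k]; last by rewrite !ord1 eqxx.
    rewrite (_ : (fun _ => _) = cst (w (graph_chart i s (cst 0) (t, c t + v)))).
      exact: is_derive_cst.
    apply/funext => t' /=; congr w; apply/matrixP => a b.
    by rewrite !mxE !ord1 eqxx.
  + have [j ji jE] : exists2 j, j != i & forall k : 'I_2, (k != i) = (k == j).
      exists (lift i ord0); first by rewrite eq_sym neq_lift.
      by move=> k; case: i {Gtv} => -[|[|//]] ?; case: k => -[|[|//]] ?.
    rewrite (big_pred1 j) => [|k]; last exact: jE.
    rewrite graph_chartE.
    apply: (@is_derive_line _ _ _ (fun t' => graph_chart i s (cst 0) (t', c t + v)) (evec j)).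
      move=> h; apply/rowP => k; rewrite !mxE eqxx /= -jE.
      case: (k == i) => /=; first by rewrite mulr0 !add0r.
      by rewrite mulr1.
    by rewrite -graph_chartE; apply: derivableP; have [] := dw j _ Gtv.
Qed.

End functions_in_charts.

Section oscillation_in_charts.
Context {R : realType} {n : nat}.
Local Notation mu := (@lebesgue_measure R).
Variables (i : 'I_n) (s : bool) (c c' : R -> R) (G : set 'rV[R]_n).
Variables (a1 a2 b1 b2 L K : R).
Hypotheses (n2 : (n <= 2)%N) (oG : open G).
Let Phi := graph_chart i s c.
Hypothesis PhiG : forall t v, t \in `]a1, a2[ -> v \in `]b1, b2[ -> G (Phi (t, v)).
Hypothesis dc : forall t, t \in `]a1, a2[ -> is_derive t 1 c (c' t).
Hypothesis cc' : forall t, t \in `]a1, a2[ -> {for t, continuous c'}.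
Hypothesis c'L : forall t, t \in `]a1, a2[ -> `|c' t| <= L.
Hypothesis LK : 1 + L <= K.
Variable w : 'rV[R]_n -> R.
Hypothesis dw : C1_on G w.

Let cPhi_v t v : (Phi (t, u)) @[u --> v] --> Phi (t, v).
Proof. by apply: cvg_graph_chart; [exact: cvg_cst|exact: cvg_id|exact: cvg_cst]. Qed.

Let cPhi_t t v : t \in `]a1, a2[ -> (Phi (u, v)) @[u --> t] --> Phi (t, v).
Proof.
move=> ta; apply: cvg_graph_chart; [exact: cvg_id|exact: cvg_cst|].
by apply: differentiable_continuous; apply/derivable1_diffP; case: (dc ta).
Qed.

Let cgrad x : G x -> gradient_l1 w y @[y --> x] --> gradient_l1 w x.
Proof.
move=> Gx; apply: (@cvg_sumr R _ _ _ (nbhs x) _ (fun k y => `|partial k w y|)) => k _.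
by apply: cvg_norm; exact: (dw k Gx).2.
Qed.

(** The two oscillation bounds say that, along each coordinate curve of the
chart, the variation of [w] is controlled by the integral of its gradient over
that curve. This holds because both families of curves stay in [G]. *)
Lemma oscillation_chart_v t u v :
  t \in `]a1, a2[ -> u \in `]b1, b2[ -> v \in `]b1, b2[ ->
  (`|w (Phi (t, v)) - w (Phi (t, u))|%:E <=
   \int[mu]_(z in `]b1, b2[) (K * gradient_l1 w (Phi (t, z)))%:E)%E.
Proof.
move=> ta ub vb.
have h1 z : z \in `]b1, b2[ -> is_derive z 1 (fun z => w (Phi (t, z)))
    ((-1) ^+ s * partial i w (Phi (t, z))).
  by move=> zb; apply: is_derive_chart_v; exact: (dw i (PhiG ta zb)).1.
have h2 z : z \in `]b1, b2[ ->
    {for z, continuous (fun z => (-1) ^+ s * partial i w (Phi (t, z)))}.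
  move=> zb; apply: cvgM; first exact: cvg_cst.
  exact: cvg_comp (cPhi_v (t := t) (v := z)) (dw i (PhiG ta zb)).2.
have h3 z : z \in `]b1, b2[ ->
    `|(-1) ^+ s * partial i w (Phi (t, z))| <= K * gradient_l1 w (Phi (t, z)).
  have L0 : 0 <= L by apply: le_trans (c'L ta).
  have K1 : 1 <= K by move: LK L0; lra.
  move=> zb; rewrite normrM normrX normrN1 expr1n mul1r.
  apply: (le_trans (partial_le_gradient_l1 w (Phi (t, z)) i)).
  by rewrite ler_peMl// sumr_ge0.
have h4 : measurable_fun `]b1, b2[ (fun z => K * gradient_l1 w (Phi (t, z))).
  apply: measurable_funM => //.
  apply: open_continuous_measurable_fun; first exact: interval_open.
  move=> z /set_mem zb; exact: cvg_comp (cPhi_v (t := t) (v := z)) (cgrad (PhiG ta zb)).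
exact: (oscillation_le_integral h1 h2 h3 h4 ub vb).
Qed.

Lemma oscillation_chart_t v t u :
  v \in `]b1, b2[ -> t \in `]a1, a2[ -> u \in `]a1, a2[ ->
  (`|w (Phi (u, v)) - w (Phi (t, v))|%:E <=
   \int[mu]_(z in `]a1, a2[) (K * gradient_l1 w (Phi (z, v)))%:E)%E.
Proof.
move=> vb ta ua.
pose dW z := \sum_(k | k != i) partial k w (Phi (z, v)) +
  (-1) ^+ s * partial i w (Phi (z, v)) * c' z.
have h1 z : z \in `]a1, a2[ -> is_derive z 1 (fun z => w (Phi (z, v))) (dW z).
  by move=> za; apply: (is_derive_chart_t n2 oG dw); [exact: PhiG|exact: dc].
have h2 z : z \in `]a1, a2[ -> {for z, continuous dW}.
  move=> za.
  have cp k : partial k w (Phi (y, v)) @[y --> z] --> partial k w (Phi (z, v)).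
    exact: cvg_comp (cPhi_t (v := v) za) (dw k (PhiG za vb)).2.
  apply: cvgD.
    exact: (@cvg_sumr R _ _ _ (nbhs z) _ (fun k y => partial k w (Phi (y, v)))).
  apply: cvgM; last exact: cc'.
  by apply: cvgM; [exact: cvg_cst|exact: cp].
have h3 z : z \in `]a1, a2[ -> `|dW z| <= K * gradient_l1 w (Phi (z, v)).
  move=> za; have L0 : 0 <= L by apply: le_trans (c'L za).
  apply: (@le_trans _ _ ((1 + L) * gradient_l1 w (Phi (z, v)))); last first.
    by rewrite ler_wpM2r// sumr_ge0.
  apply: (le_trans (ler_normD _ _)); rewrite mulrDl mul1r; apply: lerD.
    rewrite /gradient_l1 [leRHS](bigD1 i)//= (le_trans (ler_norm_sum _ _ _))//.
    by rewrite lerDr.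
  rewrite !normrM normrX normrN1 expr1n mul1r mulrC ler_pM//; first exact: c'L.
  exact: partial_le_gradient_l1.
have h4 : measurable_fun `]a1, a2[ (fun z => K * gradient_l1 w (Phi (z, v))).
  apply: measurable_funM => //.
  apply: open_continuous_measurable_fun; first exact: interval_open.
  move=> z /set_mem za; exact: cvg_comp (cPhi_t (v := v) za) (cgrad (PhiG za vb)).
exact: (oscillation_le_integral h1 h2 h3 h4 ta ua).
Qed.

End oscillation_in_charts.

(** * The local Sobolev estimate *)

Section product_estimate.
Context {R : realType}.
Local Notation mu := (@lebesgue_measure R).
Local Open Scope ereal_scope.

(** The argument of Gagliardo for the planar embedding of W^{1,1} in L^2: if
[W] is bounded both by a function [F] of [t] and by a function [H] of [v], then
[W ^ 2 <= F H], and the integral of the product [F H] is the product of the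
integrals. *)
Lemma ge0_integral_sqr_le_prod (W q : R * R -> \bar R) :
  measurable_fun setT W -> measurable_fun setT q ->
  (forall z, 0 <= W z) -> (forall z, 0 <= q z) ->
  (forall t v, W (t, v) <= \int[mu]_z q (t, z)) ->
  (forall t v, W (t, v) <= \int[mu]_z q (z, v)) ->
  \int[mu \x mu]_z (W z * W z) <=
  (\int[mu \x mu]_z q z) * (\int[mu \x mu]_z q z).
Proof.
move=> mW mq W0 q0 WF WH.
pose F t := \int[mu]_z q (t, z); pose H v := \int[mu]_z q (z, v).
have mF : measurable_fun setT F by exact: measurable_fun_fubini_tonelli_F.
have mH : measurable_fun setT H by exact: measurable_fun_fubini_tonelli_G.
have F0 t : 0 <= F t by exact: integral_ge0.
have H0 v : 0 <= H v by exact: integral_ge0.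
have mFH : measurable_fun setT (fun z : R * R => F z.1 * H z.2).
  by apply: emeasurable_funM; exact: measurableT_comp.
have FH0 (z : R * R) : 0 <= F z.1 * H z.2 by exact: mule_ge0.
apply: (@le_trans _ _ (\int[mu \x mu]_z (F z.1 * H z.2))).
  apply: ge0_le_integral => //; last by move=> [t v] _; apply: lee_pmul.
  - by move=> z _; exact: mule_ge0.
  - exact: emeasurable_funM.
rewrite (@fubini_tonelli1 _ _ _ _ R mu mu _ mFH FH0) /fubini_F /=.
under eq_integral do rewrite ge0_integralZl//.
rewrite ge0_integralZr//; last exact: integral_ge0.
rewrite -[X in X * _](@fubini_tonelli1 _ _ _ _ R mu mu _ mq q0).
by rewrite -[X in _ * X](@fubini_tonelli2 _ _ _ _ R mu mu _ mq q0).
Qed.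

(** If [h] oscillates by at most [M], then averaging [h v <= h u + M] over [u]
bounds [h] by its mean plus [M]. *)
Lemma le_mean_add (b1 b2 : R) (h : R -> R) (M : \bar R) :
  (b1 < b2)%R -> measurable_fun `]b1, b2[ h -> 0 <= M ->
  (forall v, v \in `]b1, b2[ -> 0 <= h v)%R ->
  (forall u v, u \in `]b1, b2[ -> v \in `]b1, b2[ -> (h v)%:E <= (h u)%:E + M) ->
  forall v, v \in `]b1, b2[ ->
  (h v)%:E <= ((b2 - b1)^-1)%:E * (\int[mu]_(u in `]b1, b2[) (h u)%:E) + M.
Proof.
move=> b12 mh M0 h0 hM v vb.
have b0 : (0 < b2 - b1)%R by rewrite subr_gt0.
have mB : mu `]b1, b2[ = (b2 - b1)%:E by rewrite lebesgue_measure_itv/= lte_fin b12.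
have : \int[mu]_(u in `]b1, b2[) (h v)%:E <= \int[mu]_(u in `]b1, b2[) ((h u)%:E + M).
  apply: ge0_le_integral => //.
  - by move=> u _; rewrite lee_fin; exact: h0.
  - by apply: emeasurable_funD => //; exact/measurable_EFinP.
  - by move=> u ub; exact: hM.
rewrite ge0_integralD//=; last exact/measurable_EFinP.
rewrite !integral_cst//= mB => le.
have -> : (h v)%:E = ((b2 - b1)^-1)%:E * ((h v)%:E * (b2 - b1)%:E).
  by rewrite -!EFinM mulrCA mulVf ?mulr1// gt_eqF.
apply: (@le_trans _ _ (((b2 - b1)^-1)%:E *
   (\int[mu]_(u in `]b1, b2[) (h u)%:E + M * (b2 - b1)%:E))).
  by apply: lee_wpmul2l le; rewrite lee_fin invr_ge0 ltW.
rewrite ge0_muleDr//; last 2 first.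
- by apply: integral_ge0 => u ub; rewrite lee_fin; exact: h0.
- by apply: mule_ge0 => //; rewrite lee_fin ltW.
by rewrite [X in _ + X]muleCA -EFinM mulVf ?gt_eqF// mule1.
Qed.

Local Open Scope ring_scope.

Lemma le_integral_of_oscillation (b1 b2 K k : R) (h e : R -> R) :
  0 <= K -> b1 < b2 -> (b2 - b1)^-1 + K <= k ->
  measurable_fun setT h -> measurable_fun setT e ->
  (forall v, 0 <= h v) -> (forall v, 0 <= e v) ->
  (forall u v, u \in `]b1, b2[ -> v \in `]b1, b2[ ->
     (`|h v - h u|%:E <= \int[mu]_(z in `]b1, b2[) (K * e z)%:E)%E) ->
  forall v, v \in `]b1, b2[ ->
  ((h v)%:E <= \int[mu]_(z in `]b1, b2[) (k * (h z + e z))%:E)%E.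
Proof.
move=> K0 b12 bk mh me h0 e0 osc v vb.
have ib0 : 0 <= (b2 - b1)^-1 by rewrite invr_ge0 subr_ge0 ltW.
have mh' : measurable_fun `]b1, b2[ h by exact: measurable_funS mh.
have me' : measurable_fun `]b1, b2[ e by exact: measurable_funS me.
have M0 : (0 <= \int[mu]_(z in `]b1, b2[) (K * e z)%:E)%E.
  by apply: integral_ge0 => z _; rewrite lee_fin mulr_ge0.
have hM u v' : u \in `]b1, b2[ -> v' \in `]b1, b2[ ->
    ((h v')%:E <= (h u)%:E + \int[mu]_(z in `]b1, b2[) (K * e z)%:E)%E.
  move=> ub vb'; apply: le_trans (leeD2l (h u)%:E (osc u v' ub vb')).
  by rewrite -EFinD lee_fin -lerBlDl ler_norm.
apply: (le_trans (le_mean_add b12 mh' M0 (fun v _ => h0 v) hM vb)).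
rewrite -ge0_integralZl//; [|exact/measurable_EFinP|by move=> u _; rewrite lee_fin].
rewrite -ge0_integralD//; last 4 first.
- by move=> u _; rewrite -EFinM lee_fin mulr_ge0.
- by apply/measurable_EFinP/measurable_funM.
- by move=> u _; rewrite lee_fin mulr_ge0.
- by apply/measurable_EFinP/measurable_funM.
apply: ge0_le_integral => //.
- by move=> u _; rewrite -EFinM -EFinD lee_fin addr_ge0// mulr_ge0.
- by apply/measurable_EFinP/measurable_funD; apply/measurable_funM.
- by apply/measurable_EFinP/measurable_funM => //; apply: measurable_funD.
- move=> u _; rewrite -EFinM -EFinD lee_fin mulrDr lerD// ler_wpM2r//.
    by apply: le_trans bk; rewrite lerDl.
  by apply: le_trans bk; rewrite lerDr.
Qed.

End product_estimate.

Section local_sobolev.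
Context {R : realType} {n : nat}.
Local Notation mu := (@lebesgue_measure R).
Local Notation lambda := (@lebesgue_rV R n).
Implicit Types (G V : set 'rV[R]_n) (w : 'rV[R]_n -> R).

(** What the proof of the Sobolev inequality needs from a parametrization of
the part of [G] in [V] by a rectangle: integrals over [G `&` V] are at most
[K] times those over the rectangle, which are at most [K] times those over [G],
and functions oscillate along both families of coordinate curves by at
most [K] times the integral of their gradient. *)
Record sobolev_chart G V (Phi : R * R -> 'rV[R]_n) (a1 a2 b1 b2 K : R) : Prop :=
  SobolevChart {
  chart_dom_t : a1 < a2;
  chart_dom_v : b1 < b2;
  chart_cst_ge0 : 0 <= K;
  chart_measurable :
    measurable_fun setT (Phi : measurableTypeR R * measurableTypeR R -> _);
  chart_sub : forall t v, t \in `]a1, a2[ -> v \in `]b1, b2[ -> G (Phi (t, v));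
  chart_covers : forall f : 'rV[R]_n -> \bar R,
    measurable_fun setT f -> (forall x, 0 <= f x)%E ->
    (\int[lambda]_(x in G `&` V) f x <=
     K%:E * \int[mu \x mu]_(z in `]a1, a2[ `*` `]b1, b2[) f (Phi z))%E;
  chart_bounded : forall f : 'rV[R]_n -> \bar R,
    measurable_fun setT f -> (forall x, 0 <= f x)%E ->
    (\int[mu \x mu]_(z in `]a1, a2[ `*` `]b1, b2[) f (Phi z) <=
     K%:E * \int[lambda]_(x in G) f x)%E;
  chart_oscillation_v : forall w, C1_on G w -> forall t u v,
    t \in `]a1, a2[ -> u \in `]b1, b2[ -> v \in `]b1, b2[ ->
    (`|w (Phi (t, v)) - w (Phi (t, u))|%:E <=
     \int[mu]_(z in `]b1, b2[) (K * gradient_l1 w (Phi (t, z)))%:E)%E;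
  chart_oscillation_t : forall w, C1_on G w -> forall v t u,
    v \in `]b1, b2[ -> t \in `]a1, a2[ -> u \in `]a1, a2[ ->
    (`|w (Phi (u, v)) - w (Phi (t, v))|%:E <=
     \int[mu]_(z in `]a1, a2[) (K * gradient_l1 w (Phi (z, v)))%:E)%E }.

(** In the chart, [w] is bounded along every coordinate curve by the integral
of a multiple of [w + gradient_l1 w] over that curve, and the product estimate
applies to these two bounds. *)
Lemma local_sobolev G V Phi a1 a2 b1 b2 K :
  open G -> sobolev_chart G V Phi a1 a2 b1 b2 K ->
  exists k : R, 0 <= k /\ forall w, C1_on G w ->
    measurable_fun G w -> measurable_fun G (gradient_l1 w) ->
    (forall x, G x -> 0 <= w x) ->
    (\int[lambda]_(x in G `&` V) (w x ^+ 2)%:E <=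
     k%:E * (\int[lambda]_(x in G) (w x + gradient_l1 w x)%:E *
             \int[lambda]_(x in G) (w x + gradient_l1 w x)%:E))%E.
Proof.
move=> oG [a12 b12 K0 mPhi PhiG cov bnd osc_v osc_t].
set P : set (R * R) := (`]a1, a2[ `*` `]b1, b2[) in cov bnd.
have mG := open_measurable_rV oG.
have mP : measurable (P : set (measurableTypeR R * measurableTypeR R)).
  by apply: measurableX; exact: measurable_itv.
pose k := (a2 - a1)^-1 + (b2 - b1)^-1 + K.
have ia0 : 0 <= (a2 - a1)^-1 by rewrite invr_ge0 subr_ge0 ltW.
have ib0 : 0 <= (b2 - b1)^-1 by rewrite invr_ge0 subr_ge0 ltW.
have k0 : 0 <= k by rewrite !addr_ge0.
(* K compares the integral over G and V with that over the rectangle, and k K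
   compares each of the two factors of the product estimate with an integral
   over G. *)
exists (K * (k * K) ^+ 2); split=> [|w dw mw mg w0]; first by rewrite mulr_ge0 ?sqr_ge0.
have g0 x : 0 <= gradient_l1 w x by apply: sumr_ge0.
pose wr := w \_ G; pose gr := gradient_l1 w \_ G.
have mwr : measurable_fun setT wr by apply/(measurable_restrictT _ _).1.
have mgr : measurable_fun setT gr by apply/(measurable_restrictT _ _).1.
have wr0 x : 0 <= wr x by rewrite /wr patchE; case: ifPn => // /set_mem /w0.
have gr0 x : 0 <= gr x by rewrite /gr patchE; case: ifPn.
have wrE x : G x -> wr x = w x by move=> Gx; rewrite /wr patchE mem_set.
have grE x : G x -> gr x = gradient_l1 w x by move=> Gx; rewrite /gr patchE mem_set.
have mwP : measurable_fun setT (wr \o Phi) by exact: measurableT_comp.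
have mgP : measurable_fun setT (gr \o Phi) by exact: measurableT_comp.
pose qf z := (k * (wr (Phi z) + gr (Phi z)))%:E.
have qf0 z : (0 <= qf z)%E by rewrite lee_fin mulr_ge0// addr_ge0.
have mqf : measurable_fun setT qf.
  by apply/measurable_EFinP/measurable_funM => //; exact: measurable_funD.
pose q := qf \_ P; pose W := (fun z => (wr (Phi z))%:E) \_ P.
have mq : measurable_fun setT q.
  by apply/(measurable_restrictT _ _).1 => //; exact: measurable_funS mqf.
have mW : measurable_fun setT W.
  apply/(measurable_restrictT _ _).1 => //; apply/measurable_EFinP.
  exact: measurable_funS mwP.
have q0 z : (0 <= q z)%E by rewrite /q patchE; case: ifPn.
have W0 z : (0 <= W z)%E by rewrite /W patchE; case: ifPn => // _; rewrite lee_fin.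
have k_b : (b2 - b1)^-1 + K <= k by rewrite lerD2r lerDr.
have k_a : (a2 - a1)^-1 + K <= k by rewrite lerD2r lerDl.
have W_v t v : (W (t, v) <= \int[mu]_z q (t, z))%E.
  rewrite {1}/W patchE; case: ifPn => [/set_mem[/= ta vb]|_]; last exact: integral_ge0.
  have taS : t \in `]a1, a2[%classic by rewrite inE.
  have -> : (\int[mu]_z q (t, z) = \int[mu]_(z in `]b1, b2[) qf (t, z))%E.
    rewrite [RHS]integral_mkcond; apply: eq_integral => z _.
    by rewrite /q !patchE in_setX taS.
  apply: (@le_integral_of_oscillation R b1 b2 K k (fun z => wr (Phi (t, z)))
    (fun z => gr (Phi (t, z)))) vb => //.
  - exact: measurableT_comp mwP (measurable_pair1 t).
  - exact: measurableT_comp mgP (measurable_pair1 t).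
  - move=> u v' ub vb'; rewrite !wrE; try exact: PhiG.
    rewrite [leRHS](_ : _ = \int[mu]_(z in `]b1, b2[)
        (K * gradient_l1 w (Phi (t, z)))%:E)%E; first exact: osc_v.
    by apply: eq_integral => z /set_mem zb; rewrite grE//; exact: PhiG.
have W_t t v : (W (t, v) <= \int[mu]_z q (z, v))%E.
  rewrite {1}/W patchE; case: ifPn => [/set_mem[/= ta vb]|_]; last exact: integral_ge0.
  have vbS : v \in `]b1, b2[%classic by rewrite inE.
  have -> : (\int[mu]_z q (z, v) = \int[mu]_(z in `]a1, a2[) qf (z, v))%E.
    rewrite [RHS]integral_mkcond; apply: eq_integral => z _.
    by rewrite /q !patchE in_setX vbS andbT.
  apply: (@le_integral_of_oscillation R a1 a2 K k (fun z => wr (Phi (z, v)))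
    (fun z => gr (Phi (z, v)))) ta => //.
  - exact: measurableT_comp mwP (measurable_pair2 v).
  - exact: measurableT_comp mgP (measurable_pair2 v).
  - move=> u t' ua ta'; rewrite !wrE; try exact: PhiG.
    rewrite [leRHS](_ : _ = \int[mu]_(z in `]a1, a2[)
        (K * gradient_l1 w (Phi (z, v)))%:E)%E; first exact: osc_t.
    by apply: eq_integral => z /set_mem za; rewrite grE//; exact: PhiG.
have prod := ge0_integral_sqr_le_prod mW mq W0 q0 W_v W_t.
have mw2 : measurable_fun setT (fun x => (wr x ^+ 2)%:E).
  by apply/measurable_EFinP; exact: measurable_funX.
have mwg : measurable_fun setT (fun x => (wr x + gr x)%:E).
  by apply/measurable_EFinP; exact: measurable_funD.
set I := (\int[lambda]_(x in G) (w x + gradient_l1 w x)%:E)%E.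
have I0 : (0 <= I)%E.
  by apply: integral_ge0 => x Gx; rewrite lee_fin addr_ge0// w0.
have qI : (\int[mu \x mu]_z q z <= (k * K)%:E * I)%E.
  rewrite -integral_mkcond.
  under eq_integral do rewrite /qf EFinM.
  rewrite ge0_integralZl//; last 2 first.
  - by apply/measurable_EFinP; apply: measurable_funS (measurable_funD mwP mgP).
  - by move=> z _; rewrite lee_fin addr_ge0.
  rewrite EFinM -muleA; apply: lee_wpmul2l; first by rewrite lee_fin.
  apply: (le_trans (bnd _ mwg _)) => [x|]; first by rewrite lee_fin addr_ge0.
  rewrite le_eqVlt; apply/orP; left; apply/eqP; congr (_ * _)%E.
  by apply: eq_integral => x /set_mem Gx; rewrite wrE// grE.
rewrite [leLHS](_ : _ = \int[lambda]_(x in G `&` V) (wr x ^+ 2)%:E)%E; last first.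
  by apply: eq_integral => x /set_mem[Gx _]; rewrite wrE.
apply: (le_trans (cov _ mw2 _)) => [x|]; first by rewrite lee_fin sqr_ge0.
rewrite (_ : \int[mu \x mu]_(z in P) _ = \int[mu \x mu]_z (W z * W z))%E; last first.
  rewrite integral_mkcond; apply: eq_integral => z _; rewrite /W !patchE.
  by case: ifPn; rewrite ?mule0// -EFinM expr2.
rewrite EFinM -muleA; apply: lee_wpmul2l; first by rewrite lee_fin.
apply: (le_trans prod); rewrite expr2 EFinM muleACA.
by apply: lee_pmul => //; exact: integral_ge0.
Qed.

End local_sobolev.

(** * Existence of charts *)

Lemma ge0_integral_graph_chart (R : realType) n (i : 'I_n) s (c : R -> R) :
  (n <= 2)%N -> measurable_fun setT c ->
  (n = 2%N /\ forall f : 'rV[R]_n -> \bar R,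
    measurable_fun setT f -> (forall x, 0 <= f x)%E ->
    (\int[lebesgue_rV n]_x f x = \int[lebesgue_measure]_t
      \int[lebesgue_measure]_v f (graph_chart i s c (t, v)))%E) \/
  (n = 1%N /\ forall f : 'rV[R]_n -> \bar R,
    measurable_fun setT f -> (forall x, 0 <= f x)%E -> forall t,
    (\int[lebesgue_rV n]_x f x =
      \int[lebesgue_measure]_v f (graph_chart i s c (t, v)))%E).
Proof.
move=> n2 mc; case: n n2 i => [|[|[|//]]] _ i; first by case: i.
- by right; split=> // f mf f0 t; exact: ge0_integral_graph_chart1.
- by left; split=> // f mf f0; exact: ge0_integral_graph_chart2.
Qed.

Section graph_sobolev_charts.
Context {R : realType} {n : nat}.
Local Notation mu := (@lebesgue_measure R).
Variables (i : 'I_n) (s : bool) (c c' : R -> R) (G V : set 'rV[R]_n).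
Variables (a1 a2 b1 b2 L : R).
Hypotheses (n2 : (n <= 2)%N) (oG : open G) (oV : open V).
Hypotheses (a12 : a1 < a2) (b12 : b1 < b2).
Let Phi := graph_chart i s c.
Hypothesis PhiG : forall t v, t \in `]a1, a2[ -> v \in `]b1, b2[ -> G (Phi (t, v)).
Hypothesis GVt : n = 2%N -> forall t v, G (Phi (t, v)) -> V (Phi (t, v)) ->
  t \in `]a1, a2[.
Hypothesis GVv : forall t v, G (Phi (t, v)) -> V (Phi (t, v)) ->
  t \in `]a1, a2[ -> v \in `]b1, b2[.
Hypothesis dc : forall t : R, is_derive t 1 c (c' t).
Hypothesis cc' : continuous c'.
Hypothesis c'L : forall t, t \in `]a1, a2[ -> `|c' t| <= L.

Let mc : measurable_fun setT c.
Proof.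
apply: continuous_measurable_fun => t.
by apply: differentiable_continuous; apply/derivable1_diffP; case: (dc t).
Qed.

Let mPhi := measurable_graph_chart i s mc.

Let P : set (R * R) := (`]a1, a2[ `*` `]b1, b2[).

Let mP : measurable (P : set (measurableTypeR R * measurableTypeR R)).
Proof. by apply: measurableX; exact: measurable_itv. Qed.

(** In dimension one the parameter [t] is integrated over an interval of length
[a2 - a1] on which nothing depends on it, whence this length and its inverse. *)
Let K := 1 + L + (a2 - a1) + (a2 - a1)^-1.

Let L0 : 0 <= L.
Proof.
apply: le_trans (c'L (t := (a1 + a2) / 2) _) => //.
by rewrite in_itv/=; apply/andP; split; move: a12; lra.
Qed.

Let a0 : 0 < a2 - a1. Proof. by rewrite subr_gt0. Qed.
Let ia0 : 0 < (a2 - a1)^-1. Proof. by rewrite invr_gt0. Qed.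

Section comparison.
Local Open Scope ereal_scope.
Variable f : 'rV[R]_n -> \bar R.
Hypotheses (mf : measurable_fun setT f) (f0 : forall x, 0 <= f x).

Let mGV : measurable (G `&` V).
Proof. by apply: measurableI; exact: open_measurable_rV. Qed.

Let h z := ((f \o Phi) \_ P) z.

Let h0 z : 0 <= h z.
Proof. by rewrite /h patchE; case: ifPn => // _; exact: f0. Qed.

Let mh : measurable_fun setT h.
Proof.
apply/(measurable_restrictT _ _).1 => //.
by apply: measurable_funS (measurableT_comp mf mPhi).
Qed.

Let f1 := f \_ (G `&` V).
Let mf1 : measurable_fun setT f1.
Proof. by apply/(measurable_restrictT _ _).1 => //; exact: measurable_funS mf. Qed.
Let f10 x : 0 <= f1 x. Proof. by rewrite /f1 patchE; case: ifPn. Qed.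

Let f2 := f \_ G.
Let mf2 : measurable_fun setT f2.
Proof.
apply/(measurable_restrictT _ _).1; first exact: open_measurable_rV.
exact: measurable_funS mf.
Qed.
Let f20 x : 0 <= f2 x. Proof. by rewrite /f2 patchE; case: ifPn. Qed.

Let f1h t v : t \in `]a1, a2[ -> f1 (Phi (t, v)) <= h (t, v).
Proof.
move=> ta; rewrite /f1 patchE; case: ifPn => [/set_mem[Gx Vx]|_]; last exact: h0.
rewrite /h patchE mem_set//; split => //=; exact: GVv Gx Vx ta.
Qed.

Let f1h2 t v : n = 2%N -> f1 (Phi (t, v)) <= h (t, v).
Proof.
move=> nE; rewrite /f1 patchE; case: ifPn => [/set_mem[Gx Vx]|_]; last exact: h0.
have ta := GVt nE Gx Vx.
by rewrite /h patchE mem_set//; split => //=; exact: GVv Gx Vx ta.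
Qed.

Let hf2 z : h z <= f2 (Phi z).
Proof.
rewrite /h patchE; case: ifPn => [/set_mem|_]; last exact: f20.
by case: z => t v [/= ta vb]; rewrite /f2 patchE mem_set//; exact: PhiG.
Qed.

Lemma graph_chart_covers :
  \int[lebesgue_rV n]_(x in G `&` V) f x <=
  K%:E * \int[mu \x mu]_(z in P) f (Phi z).
Proof.
have K1 : (1 <= K)%R by rewrite /K; move: L0 a0 ia0; lra.
have hP : \int[mu \x mu]_(z in P) f (Phi z) = \int[mu \x mu]_z h z.
  by rewrite integral_mkcond.
have hI : \int[mu \x mu]_z h z = \int[mu]_t \int[mu]_v h (t, v).
  exact: (@fubini_tonelli1 _ _ _ _ R mu mu _ mh h0).
have mhF : measurable_fun setT (fun t => \int[mu]_v h (t, v)).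
  exact: (@measurable_fun_fubini_tonelli_F _ _ _ _ R mu _ mh h0).
have h0F t : 0 <= \int[mu]_v h (t, v) by exact: integral_ge0.
have mh1 t : measurable_fun setT (fun v => h (t, v)).
  exact: measurableT_comp mh (measurable_pair1 t).
have mf11 t : measurable_fun setT (fun v => f1 (Phi (t, v))).
  exact: measurableT_comp (measurableT_comp mf1 mPhi) (measurable_pair1 t).
rewrite hP hI integral_mkcond -/f1.
have [[nE fub]|[nE fub]] := ge0_integral_graph_chart i s n2 mc.
  apply: (@le_trans _ _ (\int[mu]_t \int[mu]_v h (t, v))).
    rewrite (fub _ mf1 f10); apply: ge0_le_integral => //.
    - by move=> t _; exact: integral_ge0.
    - exact: (@measurable_fun_fubini_tonelli_F _ _ _ _ R mu _
        (measurableT_comp mf1 mPhi) (fun z => f10 _)).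
    - move=> t _; apply: ge0_le_integral => //; [exact: mf11|exact: mh1|].
      by move=> v _; exact: f1h2.
  rewrite -[leLHS]mul1e; apply: lee_wpmul2r; last by rewrite lee_fin.
  exact: integral_ge0.
set I := \int[_]_x f1 x; set J := \int[mu]_t _.
have IJ : I * (a2 - a1)%:E <= J.
  have mA : mu `]a1, a2[ = (a2 - a1)%:E by rewrite lebesgue_measure_itv/= lte_fin a12.
  rewrite -mA -integral_cst//.
  apply: (@le_trans _ _ (\int[mu]_(t in `]a1, a2[) \int[mu]_v h (t, v))).
    apply: ge0_le_integral => //.
    - by move=> t _; exact: integral_ge0.
    - exact: measurable_funS mhF.
    - move=> t ta; rewrite /I (fub _ mf1 f10 t); apply: ge0_le_integral => //.
      + exact: mf11.
      + exact: mh1.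
      + by move=> v _; exact: f1h.
  by apply: ge0_subset_integral.
have -> : I = (a2 - a1)^-1%:E * (I * (a2 - a1)%:E).
  by rewrite muleCA -EFinM mulVf ?mule1// gt_eqF.
apply: (@le_trans _ _ ((a2 - a1)^-1%:E * J)).
  by apply: lee_wpmul2l => //; rewrite lee_fin ltW.
apply: lee_wpmul2r; first exact: integral_ge0.
by rewrite lee_fin /K; move: L0 a0 ia0; lra.
Qed.

Lemma graph_chart_bounded :
  \int[mu \x mu]_(z in P) f (Phi z) <=
  K%:E * \int[lebesgue_rV n]_(x in G) f x.
Proof.
have K1 : 1 <= K%:E by rewrite lee_fin /K; move: L0 a0 ia0; lra.
have h0F t : 0 <= \int[mu]_v h (t, v) by exact: integral_ge0.
have mh1 t : measurable_fun setT (fun v => h (t, v)).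
  exact: measurableT_comp mh (measurable_pair1 t).
have mf21 t : measurable_fun setT (fun v => f2 (Phi (t, v))).
  exact: measurableT_comp (measurableT_comp mf2 mPhi) (measurable_pair1 t).
have mhF : measurable_fun setT (fun t => \int[mu]_v h (t, v)).
  exact: (@measurable_fun_fubini_tonelli_F _ _ _ _ R mu _ mh h0).
rewrite integral_mkcond -/h (@fubini_tonelli1 _ _ _ _ R mu mu _ mh h0) /fubini_F.
rewrite [in leRHS]integral_mkcond -/f2.
have [[nE fub]|[nE fub]] := ge0_integral_graph_chart i s n2 mc.
  apply: (@le_trans _ _ (\int[lebesgue_rV n]_x f2 x)).
    rewrite (fub _ mf2 f20); apply: ge0_le_integral => //.
    - exact: (@measurable_fun_fubini_tonelli_F _ _ _ _ R mu _
        (measurableT_comp mf2 mPhi) (fun z => f20 _)).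
    - move=> t _; apply: ge0_le_integral => //; [exact: mh1|exact: mf21].
  by rewrite -[leLHS]mul1e; apply: lee_wpmul2r => //; exact: integral_ge0.
set I := \int[_]_x f2 x.
apply: (@le_trans _ _ (\int[mu]_(t in `]a1, a2[) I)); last first.
  rewrite integral_cst//= lebesgue_measure_itv/= lte_fin a12 muleC.
  apply: lee_wpmul2r; first exact: integral_ge0.
  by rewrite -EFinD lee_fin /K; move: L0 a0 ia0; lra.
rewrite [leRHS]integral_mkcond; apply: ge0_le_integral => //.
- apply/(measurable_restrictT _ _).1 => //.
- move=> t _; rewrite patchE; case: ifPn => [/set_mem ta|ta].
    rewrite /I (fub _ mf2 f20 t); apply: ge0_le_integral => //; [exact: mh1|exact: mf21].
  rewrite integral0_eq// => v _; rewrite /h patchE ifF//.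
  by apply/negbTE; apply: contra ta; rewrite in_setX => /andP[].
Qed.

End comparison.

Lemma graph_sobolev_chart : sobolev_chart G V Phi a1 a2 b1 b2 K.
Proof.
have L1K : 1 + L <= K by rewrite /K; move: L0 a0 ia0; lra.
split => //.
- by rewrite /K; move: L0 a0 ia0; lra.
- exact: graph_chart_covers.
- exact: graph_chart_bounded.
- move=> w dw t u v ta ub vb.
  exact: (oscillation_chart_v PhiG c'L L1K dw ta ub vb).
- move=> w dw v t u vb ta ua.

  exact: (oscillation_chart_t n2 oG PhiG (fun t _ => dc t) (fun t _ => @cc' t)
    c'L L1K dw vb ta ua).
Qed.

End graph_sobolev_charts.

Section chart_existence.
Context {R : realType}.
Local Notation mu := (@lebesgue_measure R).

Definition has_sobolev_chart n (G : set 'rV[R]_n) x0 :=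
  exists V Phi a1 a2 b1 b2 K,
    [/\ open V, V x0 & sobolev_chart G V Phi a1 a2 b1 b2 K].

Lemma has_sobolev_chart0 (G : set 'rV[R]_0) x0 : open G -> G !=set0 ->
  has_sobolev_chart G x0.
Proof.
move=> oG [y Gy].
have GT x : G x by rewrite (_ : x = y)//; apply/rowP => -[].
pose o : 'rV[R]_0 := 0.
exists setT, (cst o), 0, 1, 0, 1, 1; split => //; first exact: openT.
have mG : measurable G by exact: open_measurable_rV.
have muP : ((mu \x mu) (`]0%R, 1%R[ `*` `]0%R, 1%R[) = 1)%E.
  transitivity (mu `]0%R, 1%R[ * mu `]0%R, 1%R[)%E.
    by apply: product_measure1E; exact: measurable_itv.
  by rewrite !lebesgue_measure_itv/= !lte_fin ltr01 oppr0 adde0 mule1.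
have intG (f : 'rV[R]_0 -> \bar R) : measurable_fun setT f ->
    (\int[lebesgue_rV 0]_(x in G) f x = f o)%E.
  move=> mf; rewrite integral_dirac//; last exact: measurable_funS mf.
  by rewrite diracE mem_set ?mul1e//; exact: GT.
have intP (f : 'rV[R]_0 -> \bar R) : (0 <= f o)%E ->
    (\int[mu \x mu]_(z in `]0%R, 1%R[ `*` `]0%R, 1%R[) f (cst o z) = f o)%E.
  move=> f0; rewrite [LHS](@integral_cst _ _ _ (mu \x mu)%E _ _ (f o)); last first.
    by apply: measurableX; exact: measurable_itv.
  by rewrite [X in (_ * X)%E]muP mule1.
split; rewrite ?ltr01//.
- by move=> f mf f0; rewrite setIT intG// intP// mul1e.
- by move=> f mf f0; rewrite intG// intP// mul1e.
- move=> w dw t u v _ _ _; rewrite subrr normr0.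
  by apply: integral_ge0 => z _; rewrite lee_fin mul1r sumr_ge0.
- move=> w dw t u v _ _ _; rewrite subrr normr0.
  by apply: integral_ge0 => z _; rewrite lee_fin mul1r sumr_ge0.
Qed.

Lemma ball_graph_chart n (i : 'I_n) (s : bool) (c : R -> R) (x0 : 'rV[R]_n) t v r : 0 < r ->
  ball x0 r (graph_chart i s c (t, v)) <->
  `|(-1) ^+ s * x0 ord0 i - (c t + v)| < r /\
  forall k, k != i -> `|x0 ord0 k - t| < r.
Proof.
move=> r0.
have si u : `|x0 ord0 i - (-1) ^+ s * u| = `|(-1) ^+ s * x0 ord0 i - u|.
  by case: s => /=; rewrite ?expr0 ?expr1 ?mul1r// !mulN1r opprK -opprD normrN.
split=> [[_ b]|[bi bk]].
  split=> [|k /negbTE ki]; [move: (b ord0 i)|move: (b ord0 k)]; rewrite mxE ?eqxx ?ki /=.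
    by rewrite -si.
  by [].
split=> // j k; rewrite (ord1 j) mxE; case: eqP => [->|/eqP ki].
  by rewrite /ball/= si.
exact: bk.
Qed.

(** Interior and boundary points are treated together: [x0] lies at most [r / 4]
above the graph of [c], and inside a ball the points of [G] are those above this
graph. The common size [r / 4] of the tolerances (height of [x0] above the graph,
oscillation of [c], radius of [V]) makes the rectangle large enough to contain
[G `&` V] and small enough to be mapped into the ball of radius [r]. *)
Lemma has_sobolev_chart_graph n (i : 'I_n) (s : bool) (c c' : R -> R)
    (G : set 'rV[R]_n) (x0 : 'rV[R]_n) (t0 r : R) :
  (n <= 2)%N -> open G -> 0 < r ->
  (forall t : R, is_derive t 1 c (c' t)) -> continuous c' ->
  (forall k, k != i -> x0 ord0 k = t0) ->
  c t0 <= (-1) ^+ s * x0 ord0 i <= c t0 + r / 4 ->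
  (forall t v, ball x0 r (graph_chart i s c (t, v)) -> 0 < v ->
     G (graph_chart i s c (t, v))) ->
  (forall t v, ball x0 (r / 4) (graph_chart i s c (t, v)) ->
     G (graph_chart i s c (t, v)) -> 0 < v) ->
  has_sobolev_chart G x0.
Proof.
move=> n2 oG r0 dc cc' xt0 /andP[cu uc] Gin Gout.
have r40 : 0 < r / 4 by rewrite divr_gt0.
have cc : continuous c.
  by move=> t; apply: differentiable_continuous; apply/derivable1_diffP; case: (dc t).
have [a [a0 ar ac ac']] : exists a, [/\ 0 < a, a <= r / 4,
    forall t, `|t0 - t| < a -> `|c t0 - c t| < r / 4 &
    forall t, `|t0 - t| < a -> `|c' t0 - c' t| < 1].
  have : \forall t \near t0, `|c t0 - c t| < r / 4 /\ `|c' t0 - c' t| < 1.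
    apply: filterI.
    - by have /cvgrPdist_lt/(_ _ r40) := cc t0.
    - by have /cvgrPdist_lt/(_ _ ltr01) := cc' t0.
  move=> /nbhs_ballP[e /= e0 eP]; exists (Num.min e (r / 4)).
  split; first by rewrite lt_min e0.
  - by rewrite ge_min lexx orbT.
  - by move=> t; rewrite lt_min => /andP[te _]; exact: (eP t te).1.
  - by move=> t; rewrite lt_min => /andP[te _]; exact: (eP t te).2.
have inA t : (t \in `]t0 - a, t0 + a[) = (`|t0 - t| < a).
  by rewrite in_itv/= ltr_distlC.
(* With u0 the height of x0, points of V have height less than
   a + (u0 - c t0) + (c t0 - c t), and each of these terms is at most r / 4. *)
exists (ball x0 a), (graph_chart i s c), (t0 - a), (t0 + a), 0, (3 * (r / 4)).
eexists; split; [exact: ball_open|exact: ballxx|].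
apply: (@graph_sobolev_chart _ _ i s c c' _ _ _ _ _ _ (`|c' t0| + 1)) => //.
- exact: ball_open.
- by lra.
- by lra.
- move=> t v; rewrite inA => ta; rewrite in_itv/= => /andP[v0 vr].
  apply: Gin => //; apply/ball_graph_chart => //; split.
    have := ac t ta; rewrite ltr_distl => /andP[? ?].
    rewrite ltr_distl; apply/andP; split; lra.
  by move=> k /xt0 ->; lra.
- move=> nE t v _ /ball_graph_chart[//|_ xk]; rewrite inA.
  have [k ki] : exists k, k != i.
    case: n i nE {n2 G oG Gin Gout x0 xt0 cu uc xk} => // m i [mE].
    have [j ji] : exists j : 'I_m.+1, j != i.
      by subst m; exists (lift i ord0); rewrite eq_sym neq_lift.
    by exists j.
  by rewrite -(xt0 k ki); exact: xk.
- move=> t v Gx bx; rewrite inA => ta; rewrite in_itv/=; apply/andP; split.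
    by apply: (Gout t v) => //; exact: le_ball bx.
  have [bi _] := (ball_graph_chart i s c x0 t v a0).1 bx.
  have := ac t ta; move: bi; rewrite !ltr_distl => /andP[? ?] /andP[? ?]; lra.
- move=> t; rewrite inA => /ac' /ltW; rewrite distrC => le1.
  have -> : c' t = c' t0 + (c' t - c' t0) by rewrite addrC subrK.
  by rewrite (le_trans (ler_normD _ _))// lerD2l.
Qed.

End chart_existence.

Section charts_everywhere.
Context {R : realType}.

Lemma smooth_on_line m (gamma : 'rV[R]_m -> R) : (m <= 1)%N -> smooth gamma ->
  exists c' : R -> R,
    (forall t : R, is_derive t 1 (fun t => gamma (const_mx t)) (c' t)) /\ continuous c'.
Proof.
case: m gamma => [|[|//]] gamma _ sg.
  exists (cst 0); split => [t|t]; last exact: cvg_cst.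
  rewrite (_ : (fun _ => _) = cst (gamma 0)); first exact: is_derive_cst.
  by apply/funext => u /=; congr gamma; apply/matrixP => ? [].
have [cg /(_ ord0) [dg [cdg _]]] := sg 1%N.
exists (fun t => partial ord0 gamma (const_mx t)); split => t.
  apply: (@is_derive_line _ _ _ (fun t : R => const_mx t : 'rV[R]_1) (evec ord0)).
    by move=> h; apply/matrixP => a b; rewrite !mxE !ord1 mulr1.
  exact: derivableP.
have cst_t : (const_mx u : 'rV[R]_1) @[u --> t] --> (const_mx t : 'rV[R]_1).
  by apply: cvg_rV => k; under eq_fun do rewrite mxE; rewrite mxE; exact: cvg_id.
exact: (cvg_comp _ _ cst_t (cdg (const_mx t))).
Qed.

Lemma eq_off_coordinate n (i : 'I_n) (x : 'rV[R]_n) : (n <= 2)%N ->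
  exists t0, forall k, k != i -> x ord0 k = t0.
Proof.
case: n i x => [|[|[|//]]] i x _; first by case: i.
- by exists 0 => k; rewrite !ord1 eqxx.
- exists (x ord0 (lift i ord0)) => k ki; congr (x _ _).
  by case: i k ki {x} => -[|[|//]] ? [] [|[|//]] ? // _; apply: val_inj.
Qed.

(** The graph is that of a constant function, [r / 4] below [x0]. *)
Lemma has_sobolev_chart_interior n (G : set 'rV[R]_n) x0 :
  (n <= 2)%N -> open G -> G x0 -> has_sobolev_chart G x0.
Proof.
case: n G x0 => [|m] G x0 n2 oG Gx0.
  by apply: has_sobolev_chart0 => //; exists x0.
have /nbhs_ballP[r /= r0 rG] : nbhs x0 G by exact: open_nbhs_nbhs.
have [t0 xt0] := eq_off_coordinate ord0 x0 n2.
pose c : R -> R := cst (x0 ord0 ord0 - r / 4).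
have dc (t : R) : is_derive t 1 c (cst 0 t) by exact: is_derive_cst.
have cc' : continuous (cst 0 : R -> R) by move=> t; exact: cvg_cst.
apply: (@has_sobolev_chart_graph R _ ord0 false c (cst 0) G x0 t0 r n2 oG r0 dc cc' xt0).
- by rewrite expr0 mul1r /c /=; apply/andP; split; move: r0; lra.
- by move=> t v xb _; exact: rG.
- move=> t v /ball_graph_chart[|+ _ _]; first by move: r0; lra.
  by rewrite expr0 mul1r /c /= ltr_distl => /andP[? ?]; lra.
Qed.

Lemma col'_graph_chart n (i : 'I_n) s (c : R -> R) t v :
  col' i (graph_chart i s c (t, v)) = const_mx t.
Proof. by apply/rowP => k; rewrite !mxE eq_sym (negbTE (neq_lift i k)). Qed.

(** As [x0] is not in [G] but is a limit of points of [G], the continuity of the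
graph function forces [x0] to lie on the graph. *)
Lemma has_sobolev_chart_boundary n (G : set 'rV[R]_n) x0 :
  (n <= 2)%N -> open G -> smooth_boundary G -> closure G x0 -> ~ G x0 ->
  has_sobolev_chart G x0.
Proof.
move=> n2 oG sG cGx0 nGx0.
have [|r [i [s [gamma [r0 sg Gg]]]]] := sG x0.
  by split => //; exact: subset_closure.
have [t0 xt0] := eq_off_coordinate i x0 n2.
have [c' [dc cc']] : exists c' : R -> R,
    (forall t : R, is_derive t 1 (fun t => gamma (const_mx t)) (c' t)) /\ continuous c'.
  apply: smooth_on_line => //.
  by case: n n2 {i x0 G oG sG cGx0 nGx0 gamma sg Gg xt0} => [|[|[|]]].
have colx0 : col' i x0 = const_mx t0.
  by apply/rowP => k; rewrite !mxE xt0// eq_sym neq_lift.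
pose u0 := (-1) ^+ s * x0 ord0 i.
have ucE : u0 = gamma (const_mx t0).
  apply/eqP; rewrite eq_le; apply/andP; split.
    rewrite leNgt; apply/negP => cu; apply: nGx0.
    by apply/(Gg x0 (ballxx x0 r0)); rewrite colx0.
  rewrite leNgt; apply/negP => uc.
  have cg : continuous gamma by have [] := sg 0%N.
  pose h (x : 'rV[R]_n) := (-1) ^+ s * x ord0 i - gamma (col' i x).
  have ch : h x @[x --> x0] --> h x0.
    have c1 : (fun x : 'rV[R]_n => (-1) ^+ s * x ord0 i) x @[x --> x0] -->
        (-1) ^+ s * x0 ord0 i.
      apply: (@cvgM _ _ (nbhs x0) _ (fun _ => (-1) ^+ s) (fun x : 'rV[R]_n => x ord0 i)).
        exact: cvg_cst.
      exact: coord_continuous.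
    have ccol : col' i x @[x --> x0] --> col' i x0.
      apply: (@cvg_rV R _ _ (nbhs x0) (fun x => col' i x) _ (nbhs_filter x0)) => k.
      under eq_fun do rewrite mxE.
      by rewrite mxE; exact: coord_continuous.
    have c2 : gamma (col' i x) @[x --> x0] --> gamma (col' i x0).
      exact: (cvg_comp _ _ ccol (cg (col' i x0))).
    exact: (cvgB c1 c2).
  have h0 : h x0 < 0 by rewrite /h colx0 subr_lt0.
  have near : \forall x \near x0, h x < 0 /\ ball x0 r x.
    apply: filterI; last exact: nbhsx_ballx.
    exact: (cvgr_lt (h x0) ch).
  have [x [Gx [hx bx]]] := cGx0 _ near.
  by move/(Gg x bx): Gx => gx; move: hx; rewrite /h subr_lt0 ltNge ltW.
apply: (@has_sobolev_chart_graph R n i s (fun t => gamma (const_mx t)) c' G x0 t0 r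
  n2 oG r0 dc cc' xt0).
- by rewrite -/u0 ucE lexx lerDl divr_ge0// ltW.
- move=> t v bx v0; apply/(Gg _ bx).
  by rewrite col'_graph_chart mxE eqxx mulrA -expr2 sqrr_sign mul1r ltrDl.
- move=> t v bx /(Gg _ (le_ball _ bx)).
  rewrite col'_graph_chart mxE eqxx mulrA -expr2 sqrr_sign mul1r ltrDl; apply.
  by move: r0; lra.
Qed.

End charts_everywhere.

(** * The Sobolev inequality on the domain *)

Section global_sobolev.
Context {R : realType} {n : nat}.
Local Notation lambda := (@lebesgue_rV R n).

Lemma compact_closure_rV (G : set 'rV[R]_n) : bounded_set G -> compact (closure G).
Proof.
move=> [M [Mr GM]]; apply: bounded_closed_compact; last exact: closed_closure.
exists M; split=> // x Mx y cGy.
have : closed [set z : 'rV[R]_n | `|z| <= x].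
  apply: (@closed_comp _ _ (fun z : 'rV[R]_n => `|z|) [set z | z <= x]); last exact: closed_le.
  by move=> z _; exact: norm_continuous.
move=> /closure_id cE.
have : closure [set z : 'rV[R]_n | `|z| <= x] y.
  by apply: closure_subset cGy => z Gz; exact: GM.
by rewrite -cE.
Qed.

Lemma integral_le_sum_cover (I : eqType) (s : seq I) (G : set 'rV[R]_n)
    (V : I -> set 'rV[R]_n) (f : 'rV[R]_n -> \bar R) :
  measurable G -> (forall i, measurable (V i)) -> measurable_fun G f ->
  (forall x, G x -> 0 <= f x)%E ->
  G `<=` \bigcup_(i in [set i | i \in s]) V i ->
  (\int[lambda]_(x in G) f x <= \sum_(i <- s) \int[lambda]_(x in G `&` V i) f x)%E.
Proof.
move=> mG mV mf f0 GV.
under eq_bigr do rewrite integral_mkcondr.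
have fV0 i x : G x -> (0 <= (f \_ (V i)) x)%E.
  by move=> Gx; rewrite patchE; case: ifPn => // _; exact: f0.
have mfV i : measurable_fun G (f \_ (V i)).
  apply/measurable_restrict => //; exact: measurable_funS mf.
rewrite -ge0_integral_sum//; apply: ge0_le_integral => //.
- exact: emeasurable_sum.
- move=> x Gx; have [i /= si Vx] := GV x Gx.
  elim: s si {GV} => [//|j s IH]; rewrite inE big_cons => /orP[/eqP <-|si].
    rewrite patchE mem_set// leeDl// sume_ge0// => k _; exact: fV0.
  by apply: (le_trans (IH si)); rewrite leeDr// fV0.
Qed.

(** Finitely many charts cover the closure of [G]. Every local estimate has the
integrals over the whole of [G] on its right-hand side, so it suffices to add
them: neither an extension of [w] outside [G] nor a partition of unity enters.
The same cover shows that [G] has finite measure. *)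
Lemma sobolev_by_charts (G : set 'rV[R]_n) : (n <= 2)%N ->
  bounded_domain G -> smooth_boundary G ->
  (lambda G < +oo)%E /\
  exists C : R, 0 <= C /\ forall w, C1_on G w ->
    measurable_fun G w -> measurable_fun G (gradient_l1 w) ->
    (forall x, G x -> 0 <= w x) ->
    (\int[lambda]_(x in G) (w x ^+ 2)%:E <=
     C%:E * (\int[lambda]_(x in G) (w x + gradient_l1 w x)%:E *
             \int[lambda]_(x in G) (w x + gradient_l1 w x)%:E))%E.
Proof.
move=> n2 [oG _ _ bG] sG.
have mG := open_measurable_rV oG.
pose sob (V : set 'rV[R]_n) (k : R) := forall w, C1_on G w ->
  measurable_fun G w -> measurable_fun G (gradient_l1 w) ->
  (forall x, G x -> 0 <= w x) ->
  (\int[lambda]_(x in G `&` V) (w x ^+ 2)%:E <=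
   k%:E * (\int[lambda]_(x in G) (w x + gradient_l1 w x)%:E *
           \int[lambda]_(x in G) (w x + gradient_l1 w x)%:E))%E.
have H x0 : exists Vk : set 'rV[R]_n * R,
    [/\ open Vk.1, 0 <= Vk.2 & closure G x0 ->
      [/\ Vk.1 x0, (lambda (G `&` Vk.1) < +oo)%E & sob Vk.1 Vk.2]].
  have [cG|ncG] := pselect (closure G x0); last first.
    by exists (set0, 0); split => //; exact: open0.
  have [V [Phi [a1 [a2 [b1 [b2 [K [oV Vx ch]]]]]]]] : has_sobolev_chart G x0.
    have [Gx|nGx] := pselect (G x0); first exact: has_sobolev_chart_interior.
    exact: has_sobolev_chart_boundary.
  have [k [k0 kP]] := local_sobolev oG ch.
  exists (V, k); split => //= _; split => //=.
  have [a12 b12 _ _ _ cov _ _ _] := ch.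
  have mGV : measurable (G `&` V) by apply: measurableI => //; exact: open_measurable_rV.
  have := cov (cst 1%E) (measurable_cst _) (fun _ => lee01).
  rewrite integral_cst// mul1e => /le_lt_trans; apply.
  rewrite (@integral_cst _ _ _ (lebesgue_measure \x lebesgue_measure)%E _ _ 1%E)//=; last first.
    by apply: measurableX; exact: measurable_itv.
  rewrite mul1e [X in (_ * X)%E](_ : _ =
    (lebesgue_measure `]a1, a2[ * lebesgue_measure `]b1, b2[))%E; last first.
    by apply: product_measure1E; exact: measurable_itv.
  by rewrite !lebesgue_measure_itv/= !lte_fin a12 b12 -!EFinD -!EFinM ltry.
have [Vk VkP] := choice H.
have cG := compact_closure_rV bG.
rewrite compact_cover in cG.
have [|x Gx|D D1 D2] := cG _ (closure G) (fun x => (Vk x).1).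
- by move=> x _; have [] := VkP x.
- by exists x => //; have [_ _ /(_ Gx)[]] := VkP x.
have mVk i : measurable (Vk i).1.
  by apply: open_measurable_rV; have [] := VkP i.
have cGD i : i \in finmap.enum_fset D -> closure G i.
  by move=> iD; apply: set_mem; exact: D1.
have GD : G `<=` \bigcup_(i in [set i | i \in finmap.enum_fset D]) (Vk i).1.
  by move=> x Gx; exact: D2 (subset_closure Gx).
split.
  have := @integral_le_sum_cover _ _ G _ (cst 1%E) mG mVk (measurable_cst _)
    (fun _ _ => lee01) GD.
  rewrite integral_cst// mul1e => /le_lt_trans; apply.
  rewrite big_seq; apply: lte_sum_pinfty => i iD.
  rewrite integral_cst ?mul1e; last exact: measurableI.
  by have [_ _ /(_ (cGD i iD))[]] := VkP i.
exists (\sum_(i <- finmap.enum_fset D) (Vk i).2); split.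
  by apply: sumr_ge0 => i _; have [] := VkP i.
move=> w dw mw mg w0.
have mw2 : measurable_fun G (fun x => (w x ^+ 2)%:E).
  by apply/measurable_EFinP; exact: measurable_funX.
have w20 x : G x -> (0 <= (w x ^+ 2)%:E)%E by rewrite lee_fin sqr_ge0.
apply: (le_trans (integral_le_sum_cover mG mVk mw2 w20 GD)).
rewrite -sumEFin ge0_sume_distrl; last first.
  by move=> i _; rewrite lee_fin; have [] := VkP i.
rewrite big_seq [leRHS]big_seq; apply: lee_sum => i iD.
by have [_ _ /(_ (cGD i iD))[_ _]] := VkP i; exact.
Qed.

End global_sobolev.

(** * Powers and the weight *)

Section powers.
Context {R : realType}.

(** The convention [x `^ a = 1] for [x < 0] makes powers discontinuous at [0] from
the left, whence the condition that [f] is eventually nonnegative. *)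
Lemma cvg_powR (T : Type) (F : set_system T) {FF : Filter F} (f : T -> R) (l a : R) :
  0 <= l -> 0 < l \/ 0 < a -> (\forall x \near F, 0 <= f x) ->
  f x @[x --> F] --> l -> f x `^ a @[x --> F] --> l `^ a.
Proof.
move=> l0 la f0 fl; have [lp|ln] := ltP 0 l.
  have cl : {for l, continuous (fun z : R => z `^ a)}.
    have [d _] := @is_derive1_powR R a l lp.
    by apply: differentiable_continuous; exact/derivable1_diffP.
  exact: (cvg_comp _ _ fl cl).
have l00 : l = 0 by apply/eqP; rewrite eq_le ln l0.
have a0 : 0 < a by case: la => //; rewrite l00 ltxx.
rewrite l00 powR0 ?gt_eqF// in fl *.
apply/cvgrPdist_lt => e e0.
have ea0 : 0 < e `^ a^-1 by rewrite powR_gt0.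
move/cvgrPdist_lt : fl => /(_ _ ea0) fe.
near=> x.
have fx0 : 0 <= f x by near: x.
have : `|0 - f x| < e `^ a^-1 by near: x.
rewrite !sub0r !normrN !ger0_norm ?powR_ge0// => fxe.
have -> : e = (e `^ a^-1) `^ a by rewrite -powRrM mulVf ?gt_eqF// powRr1// ltW.
by rewrite gt0_ltr_powR// nnegrE// powR_ge0.
Unshelve. all: by end_near. Qed.

Lemma is_derive_comp_dir (V : normedModType R) (f : V -> R) (h : R -> R) x v d d' :
  is_derive x v f d -> is_derive (f x) 1 h d' -> is_derive x v (h \o f) (d' * d).
Proof.
move=> df dh; apply: is_derive_line_inv.
have df' : is_derive (0 : R) 1 (fun t : R => f (t *: v + x)) d.
  apply: (@is_derive_line _ _ f (fun t : R => t *: v + x) v).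
    by move=> r; rewrite addr0 scale0r add0r.
  by rewrite scale0r add0r.
have dh' : is_derive (f ((0 : R) *: v + x)) 1 h d' by rewrite scale0r add0r.
exact: (is_derive1_comp dh' df').
Qed.

Lemma powR_mulB1 (x p : R) : 0 <= x -> 0 < p -> x `^ p = x * x `^ (p - 1).
Proof. by move=> x0 p0; rewrite mulr_powRB1. Qed.

(** At a zero of [f] the difference quotient of [f `^ p] is that of [f] times
[f `^ (p - 1)], which tends to zero; elsewhere this is the chain rule. *)
Lemma is_derive_powR (V : normedModType R) (f : V -> R) x v d p :
  1 < p -> (\forall y \near x, 0 <= f y) -> {for x, continuous f} ->
  is_derive x v f d -> is_derive x v (fun y => f y `^ p) (p * f x `^ (p - 1) * d).
Proof.
move=> p1 f0 cf df.
have fx0 : 0 <= f x by exact: (nbhs_singleton f0).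
have [fxp|fxn] := ltP 0 (f x).
  exact: (is_derive_comp_dir df (@is_derive1_powR R p (f x) fxp)).
have fxE : f x = 0 by apply/eqP; rewrite eq_le fxn fx0.
have p10 : 0 < p - 1 by rewrite subr_gt0.
rewrite fxE powR0 ?gt_eqF// mulr0 mul0r; apply/is_derive_cvg.
have line : h *: v + x @[h --> 0^'] --> x.
  rewrite -[X in _ --> X]add0r; apply: cvgD; last exact: cvg_cst.
  rewrite -(scale0r v); apply: cvgZl; exact: nbhs_dnbhs.
have f0l : \forall h \near 0^', 0 <= f (h *: v + x) by exact: (line _ f0).
have fl : f (h *: v + x) @[h --> 0^'] --> 0.
  by have := cvg_comp _ _ line cf; rewrite fxE.
have pl : f (h *: v + x) `^ (p - 1) @[h --> 0^'] --> 0.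
  have h0 := cvg_powR (lexx 0) (or_intror p10) f0l fl; rewrite powR0 in h0.
    exact: h0.
  by rewrite gt_eqF.
have dl := (is_derive_cvg f x v d).1 df.
have prod := cvgM dl pl; rewrite mulr0 in prod.
apply: (@cvg_trans _ ((h^-1 * (f (h *: v + x) - f x) *
    f (h *: v + x) `^ (p - 1)) @[h --> 0^'])); last exact: prod.
have p0 : 0 < p by rewrite (lt_trans _ p1).
apply: near_eq_cvg; near=> h.
have fh0 : 0 <= f (h *: v + x) by near: h.
by rewrite fxE powR0 ?gt_eqF// !subr0 -mulrA -powR_mulB1.
Unshelve. all: by end_near. Qed.

End powers.

Section weight.
Context {R : realType} {n : nat}.
Variables (G : set 'rV[R]_n) (phi psi : 'rV[R]_n -> R) (p : R).
Hypotheses (oG : open G) (hp : 2 <= p).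
Hypotheses (dphi : C1_on G phi) (dpsi : C1_on G psi).
Hypotheses (cphi : forall x, G x -> {for x, continuous phi}).
Hypotheses (cpsi : forall x, G x -> {for x, continuous psi}).
Hypotheses (phi0 : forall x, G x -> 0 <= phi x) (psi0 : forall x, G x -> 0 < psi x).

(** The square of this function, multiplied by [|grad psi|^4 / psi^3], is the
square of the integrand on the left of the final inequality. *)
Definition weight x := phi x `^ p * psi x `^ 2^-1.

Let dweight k x := phi x `^ p * (2^-1 * psi x `^ (2^-1 - 1) * partial k psi x) +
  psi x `^ 2^-1 * (p * phi x `^ (p - 1) * partial k phi x).

Let nearG x : G x -> \forall y \near x, G y.
Proof. by move=> Gx; exact: open_nbhs_nbhs. Qed.

Let p1 : 1 < p. Proof. by move: hp; lra. Qed.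
Let p0 : 0 < p. Proof. by move: hp; lra. Qed.
Let p10 : 0 < p - 1. Proof. by move: hp; lra. Qed.

Lemma is_derive_weight k x : G x -> is_derive x (evec k) weight (dweight k x).
Proof.
move=> Gx.
have d1 : is_derive x (evec k) (fun y => phi y `^ p) (p * phi x `^ (p - 1) * partial k phi x).
  apply: is_derive_powR p1 _ (cphi Gx) _; last exact: derivableP (dphi k Gx).1.
  by apply: filterS (nearG Gx) => y /phi0.
have d2 : is_derive x (evec k) (fun y => psi y `^ 2^-1)
    (2^-1 * psi x `^ (2^-1 - 1) * partial k psi x).
  apply: (is_derive_comp_dir _ (@is_derive1_powR R 2^-1 (psi x) (psi0 Gx))).
  exact: derivableP (dpsi k Gx).1.
exact: (is_deriveM d1 d2).
Qed.

Let partial_weight k x : G x -> partial k weight x = dweight k x.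
Proof. by move=> /(is_derive_weight k) [_ <-]. Qed.

Lemma C1_on_weight : C1_on G weight.
Proof.
move=> k x Gx; split; first by have [] := is_derive_weight k Gx.
have nphi : \forall y \near x, 0 <= phi y by apply: filterS (nearG Gx) => y /phi0.
have npsi : \forall y \near x, 0 <= psi y by apply: filterS (nearG Gx) => y /psi0 /ltW.
have cphip a : 0 < a -> phi y `^ a @[y --> x] --> phi x `^ a.
  by move=> a0; apply: cvg_powR (phi0 Gx) (or_intror a0) nphi (cphi Gx).
have cpsip a : psi y `^ a @[y --> x] --> psi x `^ a.
  exact: cvg_powR (ltW (psi0 Gx)) (or_introl (psi0 Gx)) npsi (cpsi Gx).
have cd : dweight k y @[y --> x] --> dweight k x.
  apply: (@cvgD _ _ _ (nbhs x) _
    (fun x => phi x `^ p * (2^-1 * psi x `^ (2^-1 - 1) * partial k psi x))).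
    apply: (@cvgM _ _ (nbhs x) _ (fun x => phi x `^ p)); first exact: cphip.
    apply: (@cvgM _ _ (nbhs x) _ (fun x => 2^-1 * psi x `^ (2^-1 - 1))).
      by apply: (@cvgM _ _ (nbhs x) _ (fun x => 2^-1)); [exact: cvg_cst|exact: cpsip].
    exact: (dpsi k Gx).2.
  apply: (@cvgM _ _ (nbhs x) _ (fun x => psi x `^ 2^-1)); first exact: cpsip.
  apply: (@cvgM _ _ (nbhs x) _ (fun x => p * phi x `^ (p - 1))).
    by apply: (@cvgM _ _ (nbhs x) _ (fun x => p)); [exact: cvg_cst|exact: cphip].
  exact: (dphi k Gx).2.
rewrite /prop_for /continuous_at partial_weight//.
have e : \forall y \near x, dweight k y = partial k weight y.
  by apply: filterS (nearG Gx) => y /(partial_weight k).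
by apply: cvg_trans cd; exact: near_eq_cvg e.
Qed.

Lemma partial_le_grad_norm (f : 'rV[R]_n -> R) k x : `|partial k f x| <= grad_norm f x.
Proof.
rewrite -sqrtr_sqr /grad_norm ler_wsqrtr// (bigD1 k)//= lerDl.
by apply: sumr_ge0 => j _; exact: sqr_ge0.
Qed.

Lemma gradient_weight_le x : G x ->
  gradient_l1 weight x <= n%:R * (p * (phi x `^ (p - 1) * Num.sqrt (psi x) * grad_norm phi x) +
     phi x `^ p / Num.sqrt (psi x) * grad_norm psi x).
Proof.
move=> Gx; rewrite /gradient_l1.
have s0 := psi0 Gx.
have bound k : `|partial k weight x| <=
    p * (phi x `^ (p - 1) * Num.sqrt (psi x) * grad_norm phi x) +
     phi x `^ p / Num.sqrt (psi x) * grad_norm psi x.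
  rewrite partial_weight// /dweight addrC (le_trans (ler_normD _ _))//.
  have -> : 2^-1 - 1 = - 2^-1 :> R by lra.
  rewrite powRN powR12_sqrt ?(ltW s0)//; apply: lerD.
    rewrite !normrM (ger0_norm (ltW p0)) (ger0_norm (powR_ge0 _ _)) (ger0_norm (sqrtr_ge0 _)).
    rewrite [leLHS](_ : _ =
      p * (phi x `^ (p - 1) * Num.sqrt (psi x) * `|partial k phi x|)); last by ring.
    rewrite ler_wpM2l ?(ltW p0)// ler_wpM2l ?mulr_ge0 ?powR_ge0 ?sqrtr_ge0//.
    exact: partial_le_grad_norm.
  rewrite !normrM (ger0_norm (powR_ge0 _ _)) -[leRHS]mulrA ler_wpM2l ?powR_ge0//.
  have s'0 : 0 <= (Num.sqrt (psi x))^-1 by rewrite invr_ge0 sqrtr_ge0.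
  have h0 : 0 <= 2^-1 :> R by rewrite invr_ge0.
  rewrite (ger0_norm s'0) (ger0_norm h0) ler_pM ?mulr_ge0//.
    by rewrite ler_piMl// invf_le1// ler1n.
  exact: partial_le_grad_norm.
apply: (le_trans (ler_sum _ (fun k _ => bound k))).
by rewrite sumr_const card_ord mulr_natl.
Qed.

End weight.

(** * Integral inequalities for bounded functions *)

Section bounded_measurable_functions.
Context d (T : measurableType d) (R : realType).
Variables (mu : {measure set T -> \bar R}) (D : set T).
Hypotheses (mD : measurable D) (fD : (mu D < +oo)%E).
Implicit Types f g h : T -> R.

Definition bounded_measurable f :=
  measurable_fun D f /\ exists M, forall x, D x -> `|f x| <= M.

Lemma bounded_measurable_integrable f :
  bounded_measurable f -> mu.-integrable D (EFin \o f).
Proof.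
move=> [mf [M fM]]; apply: measurable_bounded_integrable => //.
exists M; split; [exact: num_real|move=> y My x Dx].
exact: le_trans (fM x Dx) (ltW My).
Qed.

Lemma bounded_measurable_cst c : bounded_measurable (fun=> c).
Proof. by split => //; exists `|c|. Qed.

Lemma bounded_measurableD f g :
  bounded_measurable f -> bounded_measurable g -> bounded_measurable (fun x => f x + g x).
Proof.
move=> [mf [M fM]] [mg [N gN]]; split; first exact: measurable_funD.
by exists (M + N) => x Dx; rewrite (le_trans (ler_normD _ _))// lerD ?fM ?gN.
Qed.

Lemma bounded_measurableM f g :
  bounded_measurable f -> bounded_measurable g -> bounded_measurable (fun x => f x * g x).
Proof.
move=> [mf [M fM]] [mg [N gN]]; split; first exact: measurable_funM.
by exists (M * N) => x Dx; rewrite normrM ler_pM ?fM ?gN.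
Qed.

Lemma bounded_measurableX f k :
  bounded_measurable f -> bounded_measurable (fun x => f x ^+ k).
Proof.
move=> bf; elim: k => [|k IH]; first exact: bounded_measurable_cst.
by under [X in bounded_measurable X]eq_fun do rewrite exprS; exact: bounded_measurableM.
Qed.

Lemma bounded_measurable_sum (I : finType) (F : I -> T -> R) :
  (forall i, bounded_measurable (F i)) -> bounded_measurable (fun x => \sum_i F i x).
Proof.
move=> bF; split; first by apply: measurable_sum => i; have [] := bF i.
have M_ i : {M | forall x, D x -> `|F i x| <= M} by apply: cid; have [] := bF i.
exists (\sum_i sval (M_ i)) => x Dx.
by rewrite (le_trans (ler_norm_sum _ _ _))// ler_sum// => i _; exact: (svalP (M_ i)).
Qed.

Lemma bounded_measurable_powR f a : 0 <= a -> (forall x, D x -> 0 <= f x) ->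
  bounded_measurable f -> bounded_measurable (fun x => f x `^ a).
Proof.
move=> a0 f0 [mf [M fM]]; split; first exact: measurableT_comp (measurable_powR a) mf.
exists (M `^ a) => x Dx; rewrite ger0_norm ?powR_ge0//.
have := fM x Dx; rewrite ger0_norm ?f0// => fxM.
by apply: ge0_ler_powR; rewrite ?nnegrE// ?f0// (le_trans _ fxM)// f0.
Qed.

Lemma eq_bounded_measurable f g : (forall x, D x -> f x = g x) ->
  bounded_measurable f -> bounded_measurable g.
Proof.
move=> fg [mf [M fM]]; split; first by apply: eq_measurable_fun mf => x /set_mem /fg.
by exists M => x Dx; rewrite -fg ?fM.
Qed.

Lemma bounded_measurable_sqrt f : (forall x, D x -> 0 <= f x) ->
  bounded_measurable f -> bounded_measurable (fun x => Num.sqrt (f x)).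
Proof.
move=> f0 bf; have h0 : 0 <= 2^-1 :> R by rewrite invr_ge0.
apply: eq_bounded_measurable (bounded_measurable_powR h0 f0 bf) => x Dx.
by rewrite powR12_sqrt// f0.
Qed.

Lemma powR_young (t u v : R) : 0 < t -> t < 1 -> 0 <= u -> 0 <= v ->
  u `^ t * v `^ (1 - t) <= t * u + (1 - t) * v.
Proof.
move=> t0 t1 u0 v0; have t'0 : 0 < 1 - t by rewrite subr_gt0.
have := @conjugate_powR R (u `^ t) (v `^ (1 - t)) t^-1 (1 - t)^-1 (powR_ge0 _ _)
  (powR_ge0 _ _).
rewrite !invr_gt0 !invrK -!powRrM !mulfV ?gt_eqF// !powRr1//.
move=> /(_ t0 t'0); rewrite addrC subrK => /(_ erefl).
by rewrite ![_ * t]mulrC ![_ * (1 - t)]mulrC.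
Qed.

(** Young's inequality applied to [f / (F + e)] and [g / (H + e)], where [F] and
[H] are the integrals of [f] and [g], followed by the limit [e -> 0]; the shift
by [e] covers the case of vanishing integrals. *)
Lemma Rintegral_holder (t : R) f g : 0 < t -> t < 1 ->
  bounded_measurable f -> bounded_measurable g ->
  (forall x, D x -> 0 <= f x) -> (forall x, D x -> 0 <= g x) ->
  \int[mu]_(x in D) (f x `^ t * g x `^ (1 - t)) <=
  (\int[mu]_(x in D) f x) `^ t * (\int[mu]_(x in D) g x) `^ (1 - t).
Proof.
move=> t0 t1 bf bg f0 g0; have t'0 : 0 < 1 - t by rewrite subr_gt0.
set F := \int[mu]_(x in D) f x; set H := \int[mu]_(x in D) g x.
have F0 : 0 <= F by exact: Rintegral_ge0.
have H0 : 0 <= H by exact: Rintegral_ge0.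
have eps e : 0 < e -> \int[mu]_(x in D) (f x `^ t * g x `^ (1 - t)) <=
    (F + e) `^ t * (H + e) `^ (1 - t).
  move=> e0.
  have Fe : 0 < F + e by rewrite ltr_wpDl.
  have He : 0 < H + e by rewrite ltr_wpDl.
  pose c := (F + e) `^ t * (H + e) `^ (1 - t).
  have c0 : 0 <= c by rewrite mulr_ge0 ?powR_ge0.
  have bt : bounded_measurable (fun x => f x `^ t * g x `^ (1 - t)).
    by apply: bounded_measurableM; apply: bounded_measurable_powR => //; exact: ltW.
  have b1 := bounded_measurableM (bounded_measurable_cst (c * t / (F + e))) bf.
  have b2 := bounded_measurableM (bounded_measurable_cst (c * (1 - t) / (H + e))) bg.
  apply: (@le_trans _ _ (\int[mu]_(x in D)
      (c * t / (F + e) * f x + c * (1 - t) / (H + e) * g x))).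
    apply: le_Rintegral => //; [exact: bounded_measurable_integrable|
      exact: (bounded_measurable_integrable (bounded_measurableD b1 b2))|].
    move=> x Dx.
    have := powR_young t0 t1 (divr_ge0 (f0 x Dx) (ltW Fe)) (divr_ge0 (g0 x Dx) (ltW He)).
    move=> /(ler_wpM2l c0); rewrite /c.
    rewrite [X in X <= _](_ : _ = f x `^ t * g x `^ (1 - t)); last first.
      rewrite mulrACA -!powRM ?divr_ge0 ?f0 ?g0 ?(ltW Fe) ?(ltW He)//.
      by rewrite ![(_ + e) * _]mulrC !divfK ?gt_eqF.
    move/le_trans; apply; rewrite -/c le_eqVlt; apply/orP; left; apply/eqP.
    by field; rewrite !gt_eqF.
  rewrite RintegralD//; [|exact: bounded_measurable_integrable..].
  rewrite !RintegralZl//; [|exact: bounded_measurable_integrable..].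
  rewrite -/F -/H.
  have -> : c * t / (F + e) * F + c * (1 - t) / (H + e) * H =
    c * (t * (F / (F + e)) + (1 - t) * (H / (H + e))) by ring.
  rewrite -[leRHS]mulr1 ler_wpM2l//.
  have Fq : F / (F + e) <= 1 by rewrite ler_pdivrMr// mul1r lerDl ltW.
  have Hq : H / (H + e) <= 1 by rewrite ler_pdivrMr// mul1r lerDl ltW.
  rewrite [leRHS](_ : _ = t * 1 + (1 - t) * 1); last by ring.
  by rewrite lerD// ler_wpM2l// ltW.
have add_cvg (a : R) : a + e @[e --> 0^'+] --> a.
  rewrite -[X in _ --> X]addr0; apply: cvgD; first exact: cvg_cst.
  exact: cvg_at_right_filter.
have lim (a s : R) : 0 <= a -> 0 < s -> (a + e) `^ s @[e --> 0^'+] --> a `^ s.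
  move=> a0 s0; apply: cvg_powR => //; first by right.
  near=> e; have e0 : 0 < e by near: e; exact: nbhs_right_gt.
  by rewrite addr_ge0// ltW.
have cv := cvgM (lim F t F0 t0) (lim H (1 - t) H0 t'0) _.
apply: (cvgr_to_ge (cv _)); near=> e; apply: eps.
by near: e; exact: nbhs_right_gt.
Unshelve. all: by end_near. Qed.

(** Comparing [h ^ 2] with [f g], rather than [h] with a product of square
roots, leaves a polynomial identity to check in the applications. *)
Lemma Rintegral_cauchy_schwarz f g h :
  bounded_measurable f -> bounded_measurable g -> bounded_measurable h ->
  (forall x, D x -> 0 <= f x) -> (forall x, D x -> 0 <= g x) ->
  (forall x, D x -> 0 <= h x) -> (forall x, D x -> h x ^+ 2 <= f x * g x) ->
  \int[mu]_(x in D) h x <=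
  Num.sqrt (\int[mu]_(x in D) f x) * Num.sqrt (\int[mu]_(x in D) g x).
Proof.
move=> bf bg bh f0 g0 h0 hfg.
have F0 := Rintegral_ge0 mu f0; have G0 := Rintegral_ge0 mu g0.
have t0 : 0 < 2^-1 :> R by rewrite invr_gt0.
have t1 : 2^-1 < 1 :> R by lra.
have tE : 1 - 2^-1 = 2^-1 :> R by lra.
have := Rintegral_holder t0 t1 bf bg f0 g0.
rewrite tE !powR12_sqrt//; apply: le_trans.
have bs k : bounded_measurable k -> (forall x, D x -> 0 <= k x) ->
    bounded_measurable (fun x => k x `^ 2^-1).
  by move=> bk k0; exact: bounded_measurable_powR (ltW t0) k0 bk.
apply: le_Rintegral => //; first exact: bounded_measurable_integrable.
  exact: (bounded_measurable_integrable (bounded_measurableM (bs f bf f0) (bs g bg g0))).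
move=> x Dx; rewrite -powRM ?f0 ?g0// powR12_sqrt ?mulr_ge0 ?f0 ?g0//.
by rewrite -(ger0_norm (h0 x Dx)) -sqrtr_sqr ler_wsqrtr// hfg.
Qed.

End bounded_measurable_functions.

(** * Absorption of constants *)

Section real_inequalities.
Context {R : realType}.

(** The first term dominates where [l w >= 1], the second one elsewhere. *)
Lemma le_interpolation (q l w : R) : 0 < q -> q < 1 -> 0 < l -> 0 <= w ->
  w <= l * w ^+ 2 + l `^ (q - 1) * w `^ q.
Proof.
move=> q0 q1 l0 w0; have [lw|lw] := leP 1 (l * w).
  rewrite (@le_trans _ _ (l * w ^+ 2))//.
    by rewrite expr2 mulrA ler_peMl.
  by rewrite lerDl mulr_ge0 ?powR_ge0.
rewrite (@le_trans _ _ (l `^ (q - 1) * w `^ q))//; last first.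
  by rewrite lerDr mulr_ge0 ?sqr_ge0// ltW.
have -> : w = w `^ (1 - q) * w `^ q.
  rewrite -powRD; first by rewrite subrK powRr1.
  by rewrite subrK oner_eq0.
have -> : (w `^ (1 - q) * w `^ q) `^ q = w `^ q.
  rewrite -powRD; first by rewrite subrK powRr1.
  by rewrite subrK oner_eq0.
rewrite ler_wpM2r ?powR_ge0//.
have -> : l `^ (q - 1) = (l^-1) `^ (1 - q).
  by rewrite -powR_inv1 ?ltW// -powRrM mulN1r opprB.
apply: ge0_ler_powR; rewrite ?nnegrE ?invr_ge0 ?subr_ge0 ?(ltW q1) ?(ltW l0)//.
by rewrite -[leRHS]mulr1 -ler_pdivrMl ?invr_gt0// invrK ltW.
Qed.

(** Interpolation between L^2 and L^{1/p}, in absorbed form. With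
[e = (4 C)^-1] and the constant [K = e `^ (1 - 2 p)] there is nothing to prove if
[N <= K S^p]; otherwise, for [l = e / N], both terms of the interpolation bound
are at most [e N], the second one by the choice of [K]. Then [C W <= N / 2]. *)
Lemma absorb_lower_order (p C N W J S : R) : 1 < p -> 0 < C ->
  0 <= N -> 0 <= S -> 0 <= J ->
  N <= C * (W + J) ->
  (forall l, 0 < l -> W <= l * N ^+ 2 + l `^ (p^-1 - 1) * S) ->
  N <= 2 * C * J + (4 * C)^-1 `^ (1 - 2 * p) * S `^ p.
Proof.
move=> p1 C0 N0 S0 J0 NC WN.
have p0 : 0 < p by exact: lt_trans p1.
have e0 : 0 < (4 * C)^-1 by rewrite invr_gt0 mulr_gt0.
have [e eE] : exists e, e = (4 * C)^-1 by eexists.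
rewrite -eE in e0 *.
have K0 : 0 < e `^ (1 - 2 * p) by rewrite powR_gt0.
have [K KE] : exists K, K = e `^ (1 - 2 * p) by eexists.
rewrite -KE in K0 *.
have [NK|KN] := leP N (K * S `^ p).
  by rewrite (le_trans NK)// lerDr !mulr_ge0// ltW.
have Np : 0 < N by apply: le_lt_trans KN; rewrite mulr_ge0 ?powR_ge0 ?ltW.
have S_le : S <= e `^ (2 - p^-1) * N `^ p^-1.
  have SK : S `^ p <= K^-1 * N by rewrite -ler_pdivrMl ?invr_gt0// invrK ltW.
  have -> : S = (S `^ p) `^ p^-1 by rewrite -powRrM mulfV ?gt_eqF// powRr1.
  have -> : e `^ (2 - p^-1) * N `^ p^-1 = (K^-1 * N) `^ p^-1.
    rewrite powRM ?invr_ge0 ?(ltW K0)//; congr (_ * _).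
    rewrite KE -powRN -powRrM; congr (_ `^ _); field; exact: lt0r_neq0.
  apply: ge0_ler_powR; rewrite ?nnegrE ?powR_ge0 ?invr_ge0 ?(ltW p0)//.
  by rewrite mulr_ge0// invr_ge0 ltW.
have lN : 0 < e / N by rewrite divr_gt0.
have := WN _ lN.
have -> : e / N * N ^+ 2 = e * N by field; exact: lt0r_neq0.
have tail : (e / N) `^ (p^-1 - 1) * S <= e * N.
  have -> : (e / N) `^ (p^-1 - 1) = e `^ (p^-1 - 1) * N `^ (-1 * (p^-1 - 1)).
    by rewrite powRrM powR_inv1 ?(ltW Np)// powRM ?invr_ge0 ?(ltW Np) ?(ltW e0).
  have c0 : 0 <= e `^ (p^-1 - 1) * N `^ (-1 * (p^-1 - 1)) by rewrite mulr_ge0 ?powR_ge0.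
  apply: (le_trans (ler_wpM2l c0 S_le)).
  rewrite mulrACA -!powRD ?(gt_eqF e0) ?(gt_eqF Np) ?implybT//.
  have -> : p^-1 - 1 + (2 - p^-1) = 1 by ring.
  have -> : -1 * (p^-1 - 1) + p^-1 = 1 by ring.
  by rewrite !powRr1 ?(ltW Np) ?(ltW e0).
move=> W1; have W2 : W <= 2 * (e * N) by lra.
have : N <= C * (2 * (e * N) + J).
  by rewrite (le_trans NC)// ler_wpM2l ?(ltW C0)// lerD2r.
have -> : C * (2 * (e * N) + J) = N / 2 + C * J.
  by rewrite eE; field; exact: lt0r_neq0.
have : 0 <= K * S `^ p by rewrite mulr_ge0 ?powR_ge0 ?ltW.
by lra.
Qed.

Lemma young_sqrt (k e a b : R) : 0 <= k -> 0 < e -> 0 <= a -> 0 <= b ->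
  k * (Num.sqrt a * Num.sqrt b) <= e / 2 * a + k ^+ 2 / (2 * e) * b.
Proof.
move=> k0 e0 a0 b0.
have := sqr_ge0 (e * Num.sqrt a - k * Num.sqrt b).
rewrite -[X in e / 2 * X](sqr_sqrtr a0) -[X in _ / (2 * e) * X](sqr_sqrtr b0).
set x := Num.sqrt a; set y := Num.sqrt b => h.
rewrite -subr_ge0.
have -> : e / 2 * x ^+ 2 + k ^+ 2 / (2 * e) * y ^+ 2 - k * (x * y) =
   (e * x - k * y) ^+ 2 / (2 * e) by field; exact: lt0r_neq0.
by rewrite divr_ge0// mulr_ge0// ltW.
Qed.

Lemma le_addM_cross (c K Y Z : R) : 0 <= c -> 0 <= K -> 0 <= Y -> 0 <= Z ->
  c * Y + K * Z <= (c + K) * (Y + Z).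
Proof.
move=> c0 K0 Y0 Z0; rewrite -subr_ge0.
have -> : (c + K) * (Y + Z) - (c * Y + K * Z) = c * Z + K * Y by ring.
by rewrite addr_ge0 ?mulr_ge0.
Qed.

(** Young's inequality for each of the three products: the terms with [A] and
[B] receive the small factor [e], and half of [X] is absorbed on the left. *)
Lemma young_absorption (k e X A B P T D N : R) : 0 <= k -> 0 < e ->
  0 <= X -> 0 <= A -> 0 <= B -> 0 <= P -> 0 <= T -> 0 <= D ->
  X <= N * Num.sqrt D ->
  N <= k * (Num.sqrt A * Num.sqrt P + Num.sqrt X * Num.sqrt P + Num.sqrt B * Num.sqrt T) ->
  X <= e * A + e * B + k ^+ 2 * (1 + 1 / e) * (P + T) * D.
Proof.
move=> k0 e0 X0 A0 B0 P0 T0 D0 XN Nk.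
have : X <= k * (Num.sqrt A * Num.sqrt (P * D)) + k * (Num.sqrt X * Num.sqrt (P * D)) +
    k * (Num.sqrt B * Num.sqrt (T * D)).
  rewrite (le_trans XN)// (le_trans (ler_wpM2r (sqrtr_ge0 D) Nk))//.
  by rewrite !sqrtrM// le_eqVlt; apply/orP; left; apply/eqP; ring.
have PD : 0 <= P * D by rewrite mulr_ge0.
have TD : 0 <= T * D by rewrite mulr_ge0.
have hA := young_sqrt k0 e0 A0 PD.
have hX := young_sqrt k0 (@ltr01 R) X0 PD.
have hB := young_sqrt k0 e0 B0 TD.
move=> h.
have kT : 0 <= k ^+ 2 * (T * D) by rewrite mulr_ge0 ?sqr_ge0.
have -> : e * A + e * B + k ^+ 2 * (1 + 1 / e) * (P + T) * D =
  2 * (e / 2 * A + k ^+ 2 / (2 * e) * (P * D) + (k ^+ 2 / 2 * (P * D)) +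
       (e / 2 * B + k ^+ 2 / (2 * e) * (T * D))) + k ^+ 2 * (T * D).
  by field; exact: lt0r_neq0.
rewrite mulr1 in hX.
by move: h hA hX hB kT; lra.
Qed.

End real_inequalities.

Section assembly.
Context {R : realType} {n : nat}.
Local Notation lambda := (@lebesgue_rV R n).
Implicit Types (G : set 'rV[R]_n) (f : 'rV[R]_n -> R).

Lemma bounded_measurable_closure G f : open G -> bounded_set G ->
  {within closure G, continuous f} -> bounded_measurable G f.
Proof.
move=> oG bG cf; split.
  apply: continuous_in_measurable_rV => // x Gx.
  exact: within_closure_continuous cf Gx.
have := continuous_compact cf (compact_closure_rV bG).
move=> /compact_bounded[M [_ MP]]; exists (M + 1) => x Gx.
by apply: (MP (M + 1)); [rewrite ltrDl|exists x => //; exact: subset_closure].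
Qed.

Lemma bounded_measurable_C1 G f : open G -> bounded_set G -> C1_closure G f ->
  bounded_measurable G f /\ bounded_measurable G (grad_norm f).
Proof.
move=> oG bG [cf df]; split; first exact: bounded_measurable_closure.
apply: bounded_measurable_sqrt => [x _|]; first by apply: sumr_ge0 => k _; exact: sqr_ge0.
apply: bounded_measurable_sum => k; apply: bounded_measurableX.
have [_ [g cg gE]] := df k.
exact: eq_bounded_measurable gE (bounded_measurable_closure oG bG cg).
Qed.

Lemma bounded_measurable_inv G f : open G -> bounded_set G ->
  {within closure G, continuous f} -> (forall x, closure G x -> 0 < f x) ->
  bounded_measurable G (fun x => (f x)^-1).
Proof.
move=> oG bG cf f0; apply: bounded_measurable_closure => //.
apply/subspace_continuousP => x cGx; apply: cvgV; first by rewrite gt_eqF// f0.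
by move/subspace_continuousP : cf; exact.
Qed.

Lemma sobolev_W11_L2 G : (n <= 2)%N -> bounded_domain G -> smooth_boundary G ->
  (lambda G < +oo)%E /\ exists C : R, 0 < C /\ forall w, C1_on G w ->
    bounded_measurable G w -> bounded_measurable G (gradient_l1 w) ->
    (forall x, G x -> 0 <= w x) ->
    Num.sqrt (\int[lambda]_(x in G) (w x ^+ 2)) <=
      C * (\int[lambda]_(x in G) w x + \int[lambda]_(x in G) gradient_l1 w x).
Proof.
move=> n2 dG sG; have [oG _ _ bG] := dG.
have mG := open_measurable_rV oG.
have [fG [C [C0 CP]]] := sobolev_by_charts n2 dG sG.
split => //; exists (Num.sqrt C + 1); split; first by rewrite ltr_wpDl ?sqrtr_ge0.
move=> w dw bw bg w0.
have int f : bounded_measurable G f -> lambda.-integrable G (EFin \o f).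
  by move=> bf; exact: bounded_measurable_integrable.
have fin f : bounded_measurable G f ->
    (\int[lambda]_(x in G) (f x)%:E)%E = (\int[lambda]_(x in G) f x)%:E.
  by move=> bf; rewrite /Rintegral fineK//; apply: integrable_fin_num => //; exact: int.
have g0 x : 0 <= gradient_l1 w x by exact: sumr_ge0.
have := CP w dw bw.1 bg.1 w0.
rewrite (fin _ (bounded_measurableX 2 bw)) (fin _ (bounded_measurableD bw bg)).
rewrite -!EFinM lee_fin RintegralD//; [|exact: int..].
set I := _ + _ => le.
have I0 : 0 <= I by rewrite addr_ge0// Rintegral_ge0.
apply: (@le_trans _ _ (Num.sqrt C * I)); last by rewrite ler_wpM2r// lerDl.
rewrite -(ger0_norm I0) -sqrtr_sqr -sqrtrM// ler_wsqrtr//.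
Qed.

End assembly.

(** * The weighted gradient inequality *)

Section weight_estimates.
Context {R : realType} {n : nat}.
Local Notation lambda := (@lebesgue_rV R n).
Variables (G : set 'rV[R]_n) (phi psi : 'rV[R]_n -> R) (p : R).
Hypotheses (oG : open G) (bG : bounded_set G) (fG : (lambda G < +oo)%E) (hp : 2 <= p).
Hypotheses (Cphi : C1_closure G phi) (Cpsi : C1_closure G psi).
Hypotheses (phi_ge0 : forall x, closure G x -> 0 <= phi x).
Hypotheses (psi_gt0 : forall x, closure G x -> 0 < psi x).

Let p0 : 0 < p. Proof. by move: hp; lra. Qed.
Let p1 : 1 < p. Proof. by move: hp; lra. Qed.
Let p21 : 1 < 2 * p. Proof. by move: hp; lra. Qed.
Let p10 : 0 < p - 1. Proof. by move: hp; lra. Qed.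
Let mG : measurable G. Proof. exact: open_measurable_rV. Qed.
Let phi0 x : G x -> 0 <= phi x. Proof. by move=> /subset_closure /phi_ge0. Qed.
Let psi0 x : G x -> 0 < psi x. Proof. by move=> /subset_closure /psi_gt0. Qed.
Let psi0' x : G x -> 0 <= psi x. Proof. by move=> /psi0 /ltW. Qed.

Let bphi := (bounded_measurable_C1 oG bG Cphi).1.
Let bgphi := (bounded_measurable_C1 oG bG Cphi).2.
Let bpsi := (bounded_measurable_C1 oG bG Cpsi).1.
Let bgpsi := (bounded_measurable_C1 oG bG Cpsi).2.
Let bpsiV : bounded_measurable G (fun x => (psi x)^-1).
Proof. by apply: bounded_measurable_inv => //; case: Cpsi. Qed.
Let bphip a : 0 <= a -> bounded_measurable G (fun x => phi x `^ a).
Proof. by move=> a0; exact: bounded_measurable_powR. Qed.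
Let bspsi : bounded_measurable G (fun x => Num.sqrt (psi x)).
Proof. exact: bounded_measurable_sqrt. Qed.
Let bspsiV : bounded_measurable G (fun x => (Num.sqrt (psi x))^-1).
Proof.
apply: (@eq_bounded_measurable _ _ _ G (fun x => Num.sqrt (psi x)^-1)).
  by move=> x Gx; rewrite sqrtrV// psi0'.
by apply: bounded_measurable_sqrt => // x Gx; rewrite invr_ge0 psi0'.
Qed.

Definition lhs_density x := phi x `^ p / psi x * grad_norm psi x ^+ 2.
Definition phi_density x := phi x `^ (p - 2) * psi x * grad_norm phi x ^+ 2.
Definition psi_density x := grad_norm psi x ^+ 4 / psi x ^+ 3.

Let bX : bounded_measurable G lhs_density.
Proof.
apply: bounded_measurableM; last exact: bounded_measurableX.
by apply: bounded_measurableM => //; apply: bphip; exact: ltW.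
Qed.

Let bA : bounded_measurable G phi_density.
Proof.
apply: bounded_measurableM; last exact: bounded_measurableX.
by apply: bounded_measurableM => //; apply: bphip; rewrite subr_ge0.
Qed.

Let bD : bounded_measurable G psi_density.
Proof.
apply: bounded_measurableM; first exact: bounded_measurableX.
apply: (@eq_bounded_measurable _ _ _ G (fun x => (psi x)^-1 ^+ 3)).
  by move=> x _; rewrite exprVn.
exact: bounded_measurableX.
Qed.

Let grad0 (f : 'rV[R]_n -> R) x : 0 <= grad_norm f x. Proof. exact: sqrtr_ge0. Qed.
Let X0 x : G x -> 0 <= lhs_density x.
Proof. by move=> Gx; rewrite !mulr_ge0 ?powR_ge0 ?sqr_ge0 ?invr_ge0 ?psi0'. Qed.
Let A0 x : G x -> 0 <= phi_density x.
Proof. by move=> Gx; rewrite !mulr_ge0 ?powR_ge0 ?sqr_ge0 ?psi0'. Qed.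
Let D0 x : G x -> 0 <= psi_density x.
Proof. by move=> Gx; rewrite mulr_ge0 ?invr_ge0 ?exprn_ge0 ?psi0'. Qed.

Local Notation w := (weight phi psi p).

Let w0 x : 0 <= w x. Proof. by rewrite mulr_ge0 ?powR_ge0. Qed.
Let wE x : G x -> w x = phi x `^ p * Num.sqrt (psi x).
Proof. by move=> Gx; rewrite /weight powR12_sqrt// psi0'. Qed.
Let bw : bounded_measurable G w.
Proof.
apply: (@eq_bounded_measurable _ _ _ G (fun x => phi x `^ p * Num.sqrt (psi x))).
  by move=> x /wE.
by apply: bounded_measurableM => //; apply: bphip; exact: ltW.
Qed.

Let dw : C1_on G w.
Proof.
apply: C1_on_weight => //; [exact: C1_closure_on|exact: C1_closure_on|..] => x Gx.
- by case: Cphi => cf _; exact: within_closure_continuous cf Gx.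
- by case: Cpsi => cf _; exact: within_closure_continuous cf Gx.
Qed.

Let t1 x := phi x `^ (p - 1) * Num.sqrt (psi x) * grad_norm phi x.
Let t2 x := phi x `^ p / Num.sqrt (psi x) * grad_norm psi x.
Let bt1 : bounded_measurable G t1.
Proof.
by do 2 apply: bounded_measurableM => //; apply: bphip; exact: ltW.
Qed.
Let bt2 : bounded_measurable G t2.
Proof.
by do 2 apply: bounded_measurableM => //; apply: bphip; exact: ltW.
Qed.

Let grad_w x : G x -> gradient_l1 w x <= n%:R * (p * t1 x + t2 x).
Proof.
move=> Gx.
have cphi y : G y -> {for y, continuous phi}.
  by case: Cphi => cf _; exact: within_closure_continuous.
exact: (gradient_weight_le oG hp (C1_closure_on oG Cphi) (C1_closure_on oG Cpsi)
  cphi phi0 psi0 Gx).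
Qed.

Let bgw_bound : bounded_measurable G (fun x => n%:R * (p * t1 x + t2 x)).
Proof.
apply: bounded_measurableM; first exact: bounded_measurable_cst.
apply: bounded_measurableD; last exact: bt2.
by apply: bounded_measurableM; [exact: bounded_measurable_cst|exact: bt1].
Qed.

Lemma bounded_measurable_gradient_weight : bounded_measurable G (gradient_l1 w).
Proof.
split.
  apply: continuous_in_measurable_rV => // x Gx.
  apply: (@cvg_sumr R _ _ _ (nbhs x) _ (fun k y => `|partial k w y|)) => k _.
  by apply: cvg_norm; exact: (dw k Gx).2.
have [_ [M MP]] := bgw_bound; exists M => x Gx.
rewrite ger0_norm ?sumr_ge0// (le_trans (grad_w Gx))// (le_trans _ (MP x Gx))//.
exact: ler_norm.
Qed.

Let int f : bounded_measurable G f -> lambda.-integrable G (EFin \o f).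
Proof. exact: bounded_measurable_integrable. Qed.

Let P := \int[lambda]_(x in G) (phi x `^ p).
Let A := \int[lambda]_(x in G) phi_density x.
Let X := \int[lambda]_(x in G) lhs_density x.
Let D := \int[lambda]_(x in G) psi_density x.
Let B := \int[lambda]_(x in G) (phi x * psi x).
Let M := \int[lambda]_(x in G) phi x.

Let bP : bounded_measurable G (fun x => phi x `^ p).
Proof. by apply: bphip; exact: ltW. Qed.

(** The two parts of the gradient of the weight are geometric means of
[phi `^ p] with the two weighted gradient densities. *)
Lemma gradient_weight_integral :
  \int[lambda]_(x in G) gradient_l1 w x <=
  n%:R * p * (Num.sqrt A * Num.sqrt P + Num.sqrt X * Num.sqrt P).
Proof.
have t1_le : \int[lambda]_(x in G) t1 x <= Num.sqrt A * Num.sqrt P.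
  apply: Rintegral_cauchy_schwarz => //.
  - by move=> x _; exact: powR_ge0.
  - by move=> x Gx; rewrite !mulr_ge0 ?powR_ge0 ?sqrtr_ge0.
  - move=> x Gx; rewrite /t1 /phi_density !exprMn (sqr_sqrtr (psi0' Gx)).
    have -> : (phi x `^ (p - 1)) ^+ 2 = phi x `^ (p - 2) * phi x `^ p.
      have [->|x0] := eqVneq (phi x) 0.
        by rewrite (powR0 (lt0r_neq0 p10)) (powR0 (lt0r_neq0 p0)) mulr0 expr0n.
      rewrite expr2 -!powRD ?x0 ?implybT//; congr (_ `^ _); ring.
    by rewrite le_eqVlt; apply/orP; left; apply/eqP; ring.
have t2_le : \int[lambda]_(x in G) t2 x <= Num.sqrt X * Num.sqrt P.
  apply: Rintegral_cauchy_schwarz => //.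
  - by move=> x _; exact: powR_ge0.
  - by move=> x Gx; rewrite !mulr_ge0 ?powR_ge0 ?invr_ge0 ?sqrtr_ge0.
  - move=> x Gx; rewrite /t2 /lhs_density !exprMn exprVn (sqr_sqrtr (psi0' Gx)).
    by rewrite le_eqVlt; apply/orP; left; apply/eqP; ring.
have bpt1 : bounded_measurable G (fun x => p * t1 x).
  by apply: bounded_measurableM => //; exact: bounded_measurable_cst.
apply: (le_trans (le_Rintegral mG (int bounded_measurable_gradient_weight)
  (int bgw_bound) grad_w)).
rewrite RintegralZl//; last exact/int/bounded_measurableD.
rewrite -mulrA ler_wpM2l// RintegralD//; [|exact: int..].
rewrite RintegralZl//; last exact: int.
rewrite mulrDr lerD ?ler_wpM2l ?(ltW p0)// (le_trans t2_le)//.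
exact: (ler_peMl (mulr_ge0 (sqrtr_ge0 X) (sqrtr_ge0 P)) (ltW p1)).
Qed.

Lemma lhs_le_weight :
  X <= Num.sqrt (\int[lambda]_(x in G) (w x ^+ 2)) * Num.sqrt D.
Proof.
apply: Rintegral_cauchy_schwarz => //.
- exact: bounded_measurableX.
- by move=> x _; exact: sqr_ge0.
- move=> x Gx; rewrite wE// /lhs_density /psi_density !exprMn (sqr_sqrtr (psi0' Gx)).
  rewrite le_eqVlt; apply/orP; left; apply/eqP.
  by field; rewrite gt_eqF ?psi0.
Qed.

Let S := \int[lambda]_(x in G) (w x `^ p^-1).

Let bwq : bounded_measurable G (fun x => w x `^ p^-1).
Proof. by apply: bounded_measurable_powR => //; rewrite invr_ge0 ltW. Qed.

(** The exponent [1 / p] is the one for which the weight becomes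
[(phi psi)^t phi^(1 - t)] with [t = 1 / (2 p)], so that Hoelder's inequality
leaves only the integrals of [phi psi] and of [phi]. *)
Lemma weight_small_power : S `^ p <= Num.sqrt B * Num.sqrt (M `^ (2 * p - 1)).
Proof.
pose t := (2 * p)^-1.
have t0 : 0 < t by rewrite invr_gt0 mulr_gt0.
have t_lt1 : t < 1 by rewrite invf_lt1 ?mulr_gt0.
have bB : bounded_measurable G (fun x => phi x * psi x) by exact: bounded_measurableM.
have B0 x : G x -> 0 <= phi x * psi x by move=> Gx; rewrite mulr_ge0 ?phi0 ?psi0'.
have := Rintegral_holder mG fG t0 t_lt1 bB bphi B0 phi0.
rewrite -/B -/M.
rewrite (_ : \int[lambda]_(x in G) _ = S); last first.
  apply: eq_Rintegral => x /set_mem Gx.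
  have -> : w x `^ p^-1 = phi x * psi x `^ t.
    rewrite /weight powRM ?powR_ge0// -!powRrM mulfV ?gt_eqF// powRr1 ?phi0//.
    by rewrite /t invfM.
  rewrite powRM ?phi0 ?psi0'// mulrAC -powRD; last by rewrite addrC subrK oner_eq0.
  by rewrite addrC subrK powRr1 ?phi0.
have M0 : 0 <= M by exact: Rintegral_ge0.
have BB0 : 0 <= B by exact: Rintegral_ge0.
move=> S_le.
have -> : Num.sqrt B * Num.sqrt (M `^ (2 * p - 1)) = (B `^ t * M `^ (1 - t)) `^ p.
  rewrite powRM ?powR_ge0// -!powRrM -!powR12_sqrt ?powR_ge0// -powRrM.
  by congr (_ `^ _ * _ `^ _); rewrite /t; field; rewrite ?gt_eqF.
apply: ge0_ler_powR; rewrite ?nnegrE ?mulr_ge0 ?powR_ge0 ?(ltW p0)//.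
by apply: Rintegral_ge0 => x _; exact: powR_ge0.
Qed.

Lemma weight_interpolation l : 0 < l ->
  \int[lambda]_(x in G) w x <=
  l * (\int[lambda]_(x in G) (w x ^+ 2)) + l `^ (p^-1 - 1) * S.
Proof.
move=> l0.
have bw2 : bounded_measurable G (fun x => w x ^+ 2) by exact: bounded_measurableX.
have b1 : bounded_measurable G (fun x => l * w x ^+ 2).
  by apply: bounded_measurableM => //; exact: bounded_measurable_cst.
have b2 : bounded_measurable G (fun x => l `^ (p^-1 - 1) * w x `^ p^-1).
  by apply: bounded_measurableM => //; exact: bounded_measurable_cst.
rewrite -!RintegralZl//; [|exact: int..].
rewrite -RintegralD//; [|exact: int..].
apply: le_Rintegral => //; [exact: int|exact/int/bounded_measurableD|].
move=> x _; apply: le_interpolation => //; first by rewrite invr_gt0.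
by rewrite invf_lt1.
Qed.

(** The Sobolev inequality for the weight, its lower order term being absorbed
by interpolation, combined with the bounds above. *)
Lemma weighted_gradient_inequality (C : R) : 0 < C ->
  (forall f : 'rV[R]_n -> R, C1_on G f ->
    bounded_measurable G f -> bounded_measurable G (gradient_l1 f) ->
    (forall x, G x -> 0 <= f x) ->
    Num.sqrt (\int[lambda]_(x in G) (f x ^+ 2)) <=
      C * (\int[lambda]_(x in G) f x + \int[lambda]_(x in G) gradient_l1 f x)) ->
  forall eta : R, 0 < eta ->
  X <= eta * A + eta * B +
    (2 * C * (n%:R * p) + (4 * C)^-1 `^ (1 - 2 * p)) ^+ 2 * (1 + 1 / eta) *
    (P + M `^ (2 * p - 1)) * D.
Proof.
move=> C0 sobolev eta eta0.
have NC := sobolev w dw bw bounded_measurable_gradient_weight (fun x _ => w0 x).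
set N := Num.sqrt _ in NC; set J := \int[lambda]_(x in G) gradient_l1 w x in NC.
have N0 : 0 <= N by exact: sqrtr_ge0.
have N2 : N ^+ 2 = \int[lambda]_(x in G) (w x ^+ 2).
  by rewrite sqr_sqrtr// Rintegral_ge0// => x _; exact: sqr_ge0.
have S0 : 0 <= S by apply: Rintegral_ge0 => x _; exact: powR_ge0.
have J0 : 0 <= J by apply: Rintegral_ge0 => x _; exact: sumr_ge0.
have := absorb_lower_order p1 C0 N0 S0 J0 NC.
rewrite N2 => /(_ weight_interpolation).
set K := _ `^ (1 - 2 * p) => NJ.
have K0 : 0 <= K by exact: powR_ge0.
have c0 : 0 <= 2 * C * (n%:R * p).
  by apply: mulr_ge0; apply: mulr_ge0; rewrite // ltW.
set k := _ + K.
have k0 : 0 <= k by rewrite addr_ge0.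
apply: (@young_absorption R k eta X A B P (M `^ (2 * p - 1)) D N) => //.
- exact: Rintegral_ge0.
- exact: Rintegral_ge0.
- by apply: Rintegral_ge0 => x Gx; rewrite mulr_ge0 ?phi0 ?psi0'.
- by apply: Rintegral_ge0 => x _; exact: powR_ge0.
- exact: powR_ge0.
- exact: Rintegral_ge0.
- exact: lhs_le_weight.
set Y := _ + _ * Num.sqrt P; set Z := _ * Num.sqrt (M `^ _).
have Y0 : 0 <= Y by rewrite addr_ge0 ?mulr_ge0 ?sqrtr_ge0.
have Z0 : 0 <= Z by rewrite mulr_ge0 ?sqrtr_ge0.
have h1 : 2 * C * J <= 2 * C * (n%:R * p) * Y.
  rewrite -(mulrA (2 * C)) ler_wpM2l ?mulr_ge0 ?(ltW C0)//.
  exact: gradient_weight_integral.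
have h2 : K * S `^ p <= K * Z by rewrite ler_wpM2l//; exact: weight_small_power.
apply: (le_trans NJ); apply: (le_trans (lerD h1 h2)).
exact: le_addM_cross.
Qed.

End weight_estimates.

Theorem lemma3p5 (R : realType) (n : nat) (hn : (n <= 2)%N)
    (G : set 'rV[R]_n) (hG : bounded_domain G) (hbG : smooth_boundary G)
    (p : R) (hp : 2 <= p) :
  exists C : R, 0 < C /\
    forall phi psi : 'rV[R]_n -> R,
      C1_closure G phi -> C1_closure G psi ->
      (forall x, closure G x -> 0 <= phi x) ->
      (forall x, closure G x -> 0 < psi x) ->
      forall eta : R, 0 < eta ->
        \int[lebesgue_rV n]_(x in G)
            (phi x `^ p / psi x * grad_norm psi x ^+ 2)
        <= eta * (\int[lebesgue_rV n]_(x in G)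
                   (phi x `^ (p - 2) * psi x * grad_norm phi x ^+ 2))
         + eta * (\int[lebesgue_rV n]_(x in G) (phi x * psi x))
         + C * (1 + 1 / eta)
           * (\int[lebesgue_rV n]_(x in G) (phi x `^ p)
              + (\int[lebesgue_rV n]_(x in G) phi x) `^ (2 * p - 1))
           * (\int[lebesgue_rV n]_(x in G)
                (grad_norm psi x ^+ 4 / psi x ^+ 3)).
Proof.
have [fG [C [C0 CP]]] := sobolev_W11_L2 hn hG hbG.
have [oG _ _ bG] := hG.
exists ((2 * C * (n%:R * p) + (4 * C)^-1 `^ (1 - 2 * p)) ^+ 2); split.
  rewrite exprn_gt0// ltr_wpDl ?powR_gt0 ?invr_gt0 ?mulr_gt0//.
  by rewrite !mulr_ge0// ?(ltW C0)//; move: hp; lra.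
move=> phi psi Cphi Cpsi phi0 psi0 eta eta0.
exact: (weighted_gradient_inequality oG bG fG hp Cphi Cpsi phi0 psi0 C0 CP eta0).
Qed.
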